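(* Let $\Omega\subset\mathbb R^2$ be a bounded rational convex polygon with interior $\Omega^\circ$ and let $K\subset\Omega^\circ$ be compact. There is a constant $C=C(\Omega,K)$ such that, for every $P\subset K$ with $|P|=N\ge1$, $$\mathscr A_{\mathrm{symp}}(\Gamma_P)\le C\sqrt N,\qquad \mathcal H^1(\Gamma_P)\le C\sqrt N,\qquad D_\partial(F_P)\le C\sqrt N .$$ No genericity hypothesis on $P$ is required.
   Context: A bounded rational convex polygon is a compact convex polygon $\Omega\subset\mathbb R^2$ with nonempty interior $\Omega^\circ$, of the form $\Omega=\bigcap_{r=1}^s\{\lambda_r\ge0\}$, $\lambda_r(x)=\langle n_r,x\rangle+a_r$, with $n_r\in\mathbb Z^2$ the primitive inward normals and $a_r\in\mathbb R$; its sides are $S_r=\{\lambda_r=0\}\cap\Omega$. An $\Omega$-tropical series is a continuous function $F:\Omega\to\mathbb R_{\ge0}$ with $F=0$ on $\partial\Omega$ which near every point of $\Omega^\circ$ has the form $F(x)=\min_{m\in A}(c_m+\langle m,x\rangle)$ with $A\subset\mathbb Z^2$ finite and $c_m\in\mathbb R$; it is concave. Its corner locus $V(F)\subset\Omega^\circ$ is the set of points where the minimum is attained by at least two distinct affine functions. For nonempty finite $P\subset\Omega^\circ$, the tropical relaxation $F_P=G_P0_\Omega$ is the pointwise infimum of all $\Omega$-tropical series $G$ with $P\subset V(G)$; it is itself such a series, and is a minimum of finitely many affine functions with gradients in $\mathbb Z^2$. Put $\Gamma_P=V(F_P)$; it is a finite union of straight edges. An edge $e$ separating linearity regions with gradients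 $m_0,m_1\in\mathbb Z^2$ has weight $w(e)\ge1$ defined by $m_1-m_0=w(e)n_e$ with $n_e\in\mathbb Z^2$ primitive, and primitive tangent vector $v_e\in\mathbb Z^2$ obtained by rotating $n_e$ by ninety degrees. The tropical symplectic area is $\mathscr A_{\mathrm{symp}}(\Gamma_P)=\sum_e w(e)\,\ell_{\mathrm{Euc}}(e)\,\|v_e\|$, where $\ell_{\mathrm{Euc}}$ is Euclidean length, and $\mathcal H^1$ is one-dimensional Hausdorff measure. For each side $S_r$ there is a unique integer $m_{F_P}(S_r)\ge0$ such that every point of the relative interior of $S_r$ has a neighborhood $W$ with $F_P=m_{F_P}(S_r)\lambda_r$ on $W\cap\Omega$; $D_\partial(F_P)=\sum_{r=1}^s m_{F_P}(S_r)$. *)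

(* Defs.v *)
From HB Require Import structures.
From mathcomp Require Import all_boot all_order all_algebra.
From mathcomp Require Import all_classical all_reals all_analysis.

Set Implicit Arguments.
Unset Strict Implicit.
Unset Printing Implicit Defensive.

Import Order.TTheory GRing.Theory Num.Theory.
Import numFieldNormedType.Exports.

Local Open Scope classical_set_scope.
Local Open Scope ring_scope.

(** * Euclidean notions in the plane *)

Section Plane.
Variable R : realType.
Implicit Types (x y : R * R) (m : int * int) (U A : set (R * R)).

(* The library norm on [R * R] is the sup norm, hence this definition; the
   topologies agree. *)
Definition enorm x : R := Num.sqrt (x.1 ^+ 2 + x.2 ^+ 2).

Definition embed m : R * R := (m.1%:~R, m.2%:~R).

Definition dotp m x : R := m.1%:~R * x.1 + m.2%:~R * x.2.

(* The point 0 is added so that the empty set has diameter 0, not -oo. *)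
Definition ediam U : \bar R :=
  ereal_sup ([set 0%E] `|`
             [set (enorm (p.1 - p.2))%:E | p in [set p | U p.1 /\ U p.2]]).

Definition hausdorff1_delta (delta : R) A : \bar R :=
  ereal_inf [set (\sum_(0 <= i <oo) ediam (U i))%E | U in
    [set U : nat -> set (R * R) |
      A `<=` \bigcup_i U i /\ forall i, (ediam (U i) <= delta%:E)%E]].

(* [hausdorff1_delta] is nonincreasing in delta, so its limit at 0+ is a
   supremum. *)
Definition hausdorff1 A : \bar R :=
  ereal_sup [set hausdorff1_delta delta A | delta in [set d : R | 0 < d]].

End Plane.

(** * Rational polygons *)

Record halfplanes (R : realType) := Halfplanes {
  nsides : nat;
  normal : 'I_nsides -> int * int;
  offset : 'I_nsides -> R
}.

Section Polygon.
Variables (R : realType) (Om : halfplanes R).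

Definition lam (r : 'I_(nsides Om)) (x : R * R) : R :=
  dotp (normal r) x + offset r.

Definition region : set (R * R) := [set x | forall r, 0 <= lam r x].

Definition side (r : 'I_(nsides Om)) : set (R * R) :=
  [set x | lam r x = 0 /\ region x].

(* Interior of the side inside the line [lam r = 0] that it spans. *)
Definition side_relint (r : 'I_(nsides Om)) : set (R * R) :=
  [set x | side r x /\ \forall y \near x, lam r y = 0 -> region y].

(* The last two fields say that the half-planes are irredundant: the
   [side r] are the genuine sides of the polygon, each listed once. *)
Record bounded_rational_polygon : Prop := BoundedRationalPolygon {
  polygon_compact : compact region;
  polygon_interior : region° !=set0;
  normal_primitive :
    forall r : 'I_(nsides Om), coprimez (normal r).1 (normal r).2;
  side_nondegenerate :
    forall r, exists p q : R * R, [/\ side r p, side r q & p <> q];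
  normal_injective : injective (@normal R Om)
}.

(** * Tropical series *)

(* Functions on the polygon are represented by functions on the plane whose
   values outside [region] play no role. *)
Implicit Type F : R * R -> R.

Definition locally_min_at F (x : R * R) (A : seq (int * int))
    (c : int * int -> R) : Prop :=
  \forall y \near x,
    (forall m, m \in A -> F y <= c m + dotp m y) /\
    (exists2 m, m \in A & F y = c m + dotp m y).

Record tropical_series F : Prop := TropicalSeries {
  series_continuous : {within region, continuous F};
  series_ge0 : forall x, region x -> 0 <= F x;
  series_boundary : forall x, region x -> ~ region° x -> F x = 0;
  series_local : forall x, region° x -> exists A c, locally_min_at F x A c
}.

Definition corner_locus F : set (R * R) :=
  [set x | region° x /\
    exists A c, locally_min_at F x A c /\
      exists m0 m1, [/\ m0 \in A, m1 \in A, m0 <> m1,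
        F x = c m0 + dotp m0 x & F x = c m1 + dotp m1 x]].

Definition relaxation (P : set (R * R)) : R * R -> R :=
  fun x => inf [set G x | G in
    [set G : R * R -> R | tropical_series G /\ P `<=` corner_locus G]].

(** * Tropical symplectic area *)

Definition linearity_region F (m : int * int) : set (R * R) :=
  [set x | region° x /\ \forall y \near x, F y = F x + dotp m (y - x)].

(* As F is concave, its linearity regions are convex, there is one for each
   gradient, and two of them share at most one edge. *)
Definition edge F (m0 m1 : int * int) : set (R * R) :=
  closure (linearity_region F m0) `&` closure (linearity_region F m1)
  `&` region°.

(* Pairs of gradients of regions separated by an edge; the lexicographic
   condition selects one of (m0, m1) and (m1, m0). *)
Definition edges F : set ((int * int) * (int * int)) :=
  [set m | ((m.1.1 < m.2.1) || (m.1.1 == m.2.1) && (m.1.2 < m.2.2)) /\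
    exists p q, [/\ edge F m.1 m.2 p, edge F m.1 m.2 q & p <> q]].

Definition edge_weight (m0 m1 : int * int) : int :=
  gcdz (m1.1 - m0.1) (m1.2 - m0.2).

Definition edge_normal (m0 m1 : int * int) : int * int :=
  (((m1.1 - m0.1) %/ edge_weight m0 m1)%Z,
   ((m1.2 - m0.2) %/ edge_weight m0 m1)%Z).

Definition edge_tangent (m0 m1 : int * int) : int * int :=
  (- (edge_normal m0 m1).2, (edge_normal m0 m1).1).

(* An edge is a line segment, so its length is its diameter. *)
Definition symp_area F : \bar R :=
  (\esum_(m in edges F)
     ((edge_weight m.1 m.2)%:~R%:E * ediam (edge F m.1 m.2)
      * (enorm (embed R (edge_tangent m.1 m.2)))%:E))%E.

(** * Boundary degree *)

Definition is_side_mult F (r : 'I_(nsides Om)) (k : nat) : Prop :=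
  forall x, side_relint r x ->
    \forall y \near x, region y -> F y = k%:R * lam r y.

(* The multiplicity k is unique when it exists; the value is +oo if there is
   none, so that a finite value also asserts existence. *)
Definition side_mult F (r : 'I_(nsides Om)) : \bar R :=
  xget +oo%E [set k%:R%:E | k in is_side_mult F r].

Definition boundary_degree F : \bar R :=
  (\sum_(r < nsides Om) side_mult F r)%E.

End Polygon.

(* Main.v *)
Require Import Defs.
From mathcomp Require Import all_boot all_order all_algebra.
From mathcomp Require Import all_classical all_reals all_analysis.
From mathcomp Require Import perm ring lra zify.
Import Order.TTheory GRing.Theory Num.Theory.
Import numFieldNormedType.Exports.
Local Open Scope classical_set_scope.
Local Open Scope ring_scope.

Set Implicit Arguments.
Unset Strict Implicit.
Unset Printing Implicit Defensive.

(* If some competitor [G] satisfies [G <= k lam_r] for all [r] on the polygon,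
   every slope of the relaxation [F] lies in [k] times the convex hull of the
   normals, so [F] is a minimum of finitely many affine functions whose slopes
   are O(k), and the multiplicity of each side is at most [k].  Such a [G] with
   [k = O(sqrt N)] exists because [N + 1] monomials suffice for a tropical
   polynomial singular at [N] given points (tropical Cramer rule), and they can
   be chosen with exponents of size O(sqrt N).

   For the lengths, slice by horizontal lines: along such a line the horizontal
   slope of the concave function [F] decreases by O(k) in total, and an edge
   across which the gradient jumps by [d] and whose vertical extent is [h]
   contributes [|d.1| h] to the integral over all lines.  Adding the vertical
   slicing gives [|d| * length], as [d] is normal to the edge. *)

(** The square root is a count of lattice points: the box [{0..q}^2] has [(q + 1)^2] of them, so
    side length about [sqrt N] already provides [N + 1] slopes. The relaxation is an infimum over a
    family that may be infinite, whose members are known only through local data, while the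
    quantities to bound are read from germs: linearity regions, local minima, behaviour near a side.
    Each of them is therefore compared with one finite representation valid on the whole closed
    polygon, [min_rep]. As [P] is arbitrary, many slopes may be active along the same segment, and
    the pairs of active slopes overcount it. Summing over one distinguished pair per segment keeps
    the slicing estimate valid, and this pair carries the full jump of the gradient across an edge.
    Because slopes are integers, the integral over slices becomes a sum over integer levels of
    lengths of disjoint intervals. *)

Section Dotp.
Variable R : realType.
Implicit Types (x y : R * R) (m : int * int).

Lemma dotpD m x y : dotp m (x + y) = dotp m x + dotp m y.
Proof. by rewrite /dotp /=; ring. Qed.

Lemma dotpN m x : dotp m (- x) = - dotp m x.
Proof. by rewrite /dotp /=; ring. Qed.

Lemma dotpB m x y : dotp m (x - y) = dotp m x - dotp m y.
Proof. by rewrite dotpD dotpN. Qed.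

Lemma dotpZ m a x : dotp m (a *: x) = a * dotp m x.
Proof. by rewrite /dotp /= /GRing.scale /=; ring. Qed.

Lemma dotp_line m x v (t : R) : dotp m (x + t *: v) = dotp m x + t * dotp m v.
Proof. by rewrite dotpD dotpZ. Qed.

Lemma continuous_dotp m : continuous (dotp m : R * R -> R).
Proof.
move=> x; rewrite /dotp.
apply: cvgD; apply: cvgM; try exact: cvg_cst.
- exact: cvg_fst.
- exact: cvg_snd.
Qed.

Lemma continuous_affine (b : R) m : continuous (fun x => b + dotp m x).
Proof. by move=> x; apply: cvgD; [exact: cvg_cst|exact: continuous_dotp]. Qed.

Lemma continuous_line x v : continuous (fun t : R => x + t *: v).
Proof.
by move=> t; apply: cvgD; [exact: cvg_cst|apply: cvgZr_tmp; exact: cvg_id].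
Qed.

Lemma near_line x v (P : set (R * R)) : (\forall y \near x, P y) ->
  \forall t \near (0 : R), P (x + t *: v).
Proof.
move=> Px; apply: (@continuous_line x v 0).
by rewrite scale0r addr0.
Qed.

Lemma near0_pos (P : set R) : (\forall t \near (0 : R), P t) ->
  exists2 t, 0 < t & P t /\ P (- t).
Proof.
move=> /nbhs_ballP[e /= e0 He]; exists (e / 2); first by rewrite divr_gt0.
split; apply: He; rewrite /ball /= sub0r ?opprK ?normrN gtr0_norm ?divr_gt0//;
  by rewrite ltr_pdivrMr// mulr_natr mulr2n ltrDl.
Qed.

Lemma dotp_eq0 m : (forall x : R * R, dotp m x = 0) -> m = (0, 0).
Proof.
move=> H; have := H (1, 0); have := H (0, 1); rewrite /dotp /=.
rewrite !mulr0 !mulr1 add0r addr0 => /eqP + /eqP; rewrite !intr_eq0.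
by case: m {H} => a b /= /eqP -> /eqP ->.
Qed.

End Dotp.

(** * The polygon *)

Section PolygonGeometry.
Variables (R : realType) (Om : halfplanes R).
Hypothesis HOm : bounded_rational_polygon Om.
Implicit Types (x y z u : R * R) (m : int * int) (r : 'I_(nsides Om)).

Lemma lamE r x : lam r x = offset r + dotp (normal r) x.
Proof. by rewrite /lam addrC. Qed.

Lemma continuous_lam r : continuous (@lam R Om r).
Proof.
move=> x; apply: cvgD; [exact: continuous_dotp|exact: cvg_cst].
Qed.

Lemma lam_line r x v (t : R) :
  lam r (x + t *: v) = lam r x + t * dotp (normal r) v.
Proof. by rewrite /lam dotp_line addrAC. Qed.

Lemma lam_segment r x y (t : R) :
  lam r (x + t *: (y - x)) = (1 - t) * lam r x + t * lam r y.
Proof. by rewrite lam_line dotpB /lam; ring. Qed.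

Lemma normal_neq0 r : normal r <> (0, 0).
Proof. by move=> n0; have := normal_primitive HOm r; rewrite n0. Qed.

Lemma interiorP x : (region Om)° x <-> forall r, 0 < lam r x.
Proof.
split=> [intx r|lx].
- have rx : region Om x := interior_subset intx.
  rewrite lt_neqAle rx andbT; apply/eqP => lr0.
  apply: (@normal_neq0 r); apply: (@dotp_eq0 R) => v.
  have [t t0 [Ht Hmt]] := near0_pos (near_line v intx).
  have := Ht r; have := Hmt r; rewrite !lam_line -lr0 !add0r mulNr.
  rewrite oppr_ge0 pmulr_rle0// pmulr_rge0// => h1 h2.
  by apply/eqP; rewrite eq_le h1 h2.
- rewrite /interior /=.
  suff : \forall y \near x, forall r, 0 < lam r y.
    by apply: filterS => y H r; apply: ltW; apply: H.
  apply: (@filter_forall _ _ (fun r y => 0 < lam r y) (nbhs x)) => r.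
  have H : \forall z \near lam r x, 0 < z by exact: lt_nbhsr.
  exact: (@continuous_lam r x _ H).
Qed.

Lemma region_segment x y (t : R) : region Om x -> region Om y ->
  0 <= t <= 1 -> region Om (x + t *: (y - x)).
Proof.
move=> rx ry /andP[t0 t1] r; rewrite lam_segment.
by rewrite addr_ge0 ?mulr_ge0 ?subr_ge0.
Qed.

Lemma interior_segment x y (t : R) : (region Om)° x -> region Om y ->
  0 <= t < 1 -> (region Om)° (x + t *: (y - x)).
Proof.
move=> /interiorP ix ry /andP[t0 t1]; apply/interiorP => r; rewrite lam_segment.
by rewrite ltr_wpDr ?mulr_ge0 ?mulr_gt0 ?subr_gt0.
Qed.

Lemma boundary_lam0 x : region Om x -> ~ (region Om)° x ->
  exists r, lam r x = 0.
Proof.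
move=> rx nx; apply: contrapT => H; apply: nx; apply/interiorP => r.
rewrite lt_neqAle rx andbT; apply/eqP => l0; apply: H.
by exists r.
Qed.

Lemma region_bounded :
  exists2 B : R, 0 < B & forall x, region Om x -> `|x.1| <= B /\ `|x.2| <= B.
Proof.
have [M [_ HM]] := compact_bounded (polygon_compact HOm).
exists (`|M| + 1); first by rewrite ltr_wpDl.
move=> x rx; have : `|x| <= `|M| + 1.
  by apply: HM => //; rewrite (le_lt_trans (ler_norm M))// ltrDl.
by rewrite prod_normE ge_max => /andP.
Qed.

(** If no normal had positive product with [u], the ray from [x] in direction [- u] would never
    leave the polygon, which is bounded. *)
Lemma exists_exit_normal x u : region Om x -> u <> 0 ->
  exists r, 0 < dotp (normal r) u.
Proof.
move=> rx u0; apply: contrapT => H.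
have [B B0 HB] := region_bounded.
have ray (t : R) : 0 <= t -> region Om (x + (- t) *: u).
  move=> t0 r; rewrite lam_line mulNr subr_ge0.
  apply: (le_trans _ (rx r)); rewrite mulr_ge0_le0// leNgt.
  by apply/negP => ?; apply: H; exists r.
have ray_coord (a b : R) : (forall t, 0 <= t -> `|a - t * b| <= B) -> b = 0.
  move=> Hab; apply/eqP; apply: contrapT => /negP b0.
  have nb : 0 < `|b| by rewrite normr_gt0.
  have := Hab ((B + `|a| + 1) / `|b|).
  rewrite divr_ge0 ?addr_ge0 ?(ltW B0)// => /(_ isT) H1.
  have : `|(B + `|a| + 1) / `|b| * b| <= `|a| + B.
    rewrite -[X in `|X|](subKr a); apply: (le_trans (ler_normB _ _)).
    by rewrite lerD2l.
  rewrite normrM normrM normrV ?unitfE ?normr_eq0 ?normr_id -?normr_gt0 ?normr_id//.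
  rewrite divfK ?gt_eqF// ger0_norm ?addr_ge0 ?(ltW B0)//.
  by rewrite (addrC B) gerDl ler10.
apply: u0; rewrite [u]surjective_pairing; congr pair.
- apply: (ray_coord x.1) => t t0.
  by have [h _] := HB _ (ray t t0); rewrite -mulNr; exact: h.
- apply: (ray_coord x.2) => t t0.
  by have [_ h] := HB _ (ray t t0); rewrite -mulNr; exact: h.
Qed.

(** Walk from [x] in direction [- u] until the first exit, at time [T r] through side [r]. The
    affine function is still nonnegative there, so its loss [T r * dotp m u] is at most its value at
    [x], hence at most [k * lam r x], which is [k * T r * dotp (normal r) u]. Over all [u] this
    compares support functions, placing [m] in [k] times the hull of the normals. *)
Lemma slope_le_exit (k : R) m (b : R) x u :
  (region Om)° x -> u <> 0 ->
  (forall y, region Om y -> 0 <= b + dotp m y) ->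
  (forall r, b + dotp m x <= k * lam r x) ->
  exists r, dotp m u <= k * dotp (normal r) u.
Proof.
move=> ix u0 ge0 lek; have rx := interior_subset ix.
move/interiorP: ix => ix.
have [r0 r0u] := exists_exit_normal rx u0.
pose T r := lam r x / dotp (normal r) u.
case: (@Order.TotalTheory.arg_minP _ _ _ r0
  (fun r => 0 < dotp (normal r) u) T r0u) => r ru Tr.
exists r.
have T0 : 0 < T r by rewrite divr_gt0.
have : region Om (x + (- T r) *: u).
  move=> r'; rewrite lam_line mulNr subr_ge0.
  have [r'u|r'u] := ltP 0 (dotp (normal r') u).
    by rewrite -ler_pdivlMr//; exact: Tr.
  by rewrite (le_trans _ (ltW (ix r')))// mulr_ge0_le0// ltW.
move=> /ge0; rewrite dotp_line mulNr addrA subr_ge0 => H.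
have {}H := le_trans H (lek r).
rewrite -(ler_pM2l T0); apply: (le_trans H).
by rewrite /T mulrCA divfK// gt_eqF.
Qed.

End PolygonGeometry.

(** * Concavity of tropical series *)

Section Concavity.
Variables (R : realType) (Om : halfplanes R).
Hypothesis HOm : bounded_rational_polygon Om.
Implicit Types (x y z u : R * R) (m : int * int) (G : R * R -> R).

Lemma series_midpoint_concave G z v : tropical_series Om G ->
  (region Om)° z -> \forall h \near (0 : R),
    G (z + h *: v) + G (z - h *: v) <= 2 * G z.
Proof.
move=> HG iz; have [A [c Ac]] := series_local HG iz.
have [_ [m mA Gz]] := nbhs_singleton Ac.
have near_le : \forall y \near z, G y <= c m + dotp m y.
  by apply: filterS Ac => y [+ _]; apply.
have near_plus := near_line v near_le.
have near_minus := near_line (- v) near_le.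
apply: filterS2 near_plus near_minus => h.
rewrite !dotp_line dotpN scalerN Gz => Hp Hm.
by apply: (le_trans (lerD Hp Hm)); rewrite le_eqVlt; apply/orP; left;
  apply/eqP; ring.
Qed.

Lemma series_continuous_segment G x y : tropical_series Om G ->
  region Om x -> region Om y ->
  {within `[0, 1], continuous (fun t : R => G (x + t *: (y - x)))}.
Proof.
move=> HG rx ry; apply/subspace_continuousP => t t01.
have rt (s : R) : `[0, 1]%classic s -> region Om (x + s *: (y - x)).
  by rewrite /= in_itv /=; exact: region_segment.
have /subspace_continuousP /(_ _ (rt _ t01)) := series_continuous HG.
apply: cvg_trans => /= U; rewrite /= !nbhs_simpl /= => HU.
have := @continuous_line R x (y - x) t _ HU.
rewrite /= !nbhs_simpl /within /=; apply: filterS => s /= H s01.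
by apply: H; exact: rt.
Qed.

(* At an interior minimum of [G - chord + e t (1 - t)] the second difference
   would be nonnegative, while local concavity of [G] makes it negative. *)
Lemma series_concave G x y (t : R) : tropical_series Om G ->
  (region Om)° x -> region Om y -> 0 <= t <= 1 ->
  (1 - t) * G x + t * G y <= G (x + t *: (y - x)).
Proof.
move=> HG ix ry t01; have rx := interior_subset ix.
rewrite leNgt; apply/negP => lt0.
pose g s := G (x + s *: (y - x)) : R.
(* The assumed defect at [t] also serves as coefficient of the parabola:
   [f t = e * (t * (1 - t) - 1)] stays negative because [t * (1 - t) <= 1/4], while [f] vanishes at
   0 and 1, so the minimum is attained strictly inside. *)
pose e := (1 - t) * G x + t * G y - g t.
have e0 : 0 < e by rewrite subr_gt0.
pose f s := g s - ((1 - s) * G x + s * G y) + e * (s * (1 - s)).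
have g0 : g 0 = G x by rewrite /g scale0r addr0.
have g1 : g 1 = G y by rewrite /g scale1r addrC subrK.
have f0 : f 0 = 0 by rewrite /f g0; ring.
have f1 : f 1 = 0 by rewrite /f g1; ring.
have ft : f t < 0.
  have -> : f t = e * (t * (1 - t) - 1) by rewrite /f /e; ring.
  rewrite pmulr_rlt0// subr_lt0; case/andP: t01 => t0 t1.
  by rewrite (@le_lt_trans _ _ (1/4))//; [have := sqr_ge0 (t - 1/2); nra|lra].
have cf : {within `[0, 1], continuous f}.
  have c1 : continuous (fun s : R => (1 - s) * G x + s * G y).
    move=> s; apply: cvgD; apply: cvgM; try exact: cvg_cst; last exact: cvg_id.
    by apply: cvgB; [exact: cvg_cst|exact: cvg_id].
  have c2 : continuous (fun s : R => e * (s * (1 - s))).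
    move=> s; apply: cvgM; first exact: cvg_cst.
    apply: cvgM; first exact: cvg_id.
    by apply: cvgB; [exact: cvg_cst|exact: cvg_id].
  move=> s; apply: cvgD; last exact: (continuous_subspaceT c2).
  apply: cvgB; last exact: (continuous_subspaceT c1).
  exact: (series_continuous_segment HG rx ry).
have [s s01 smin] := EVT_min ler01 cf.
have fs : f s < 0.
  by apply: le_lt_trans ft; apply: smin; rewrite in_itv.
have {}s01 : 0 < s < 1.
  move: s01; rewrite in_itv /= !le_eqVlt.
  case/andP => /orP[/eqP s0|->] /orP[/eqP s1|->] //.
  - by move: fs; rewrite -s0 f0 ltxx.
  - by move: fs; rewrite -s0 f0 ltxx.
  - by move: fs; rewrite s1 f1 ltxx.
have iz : (region Om)° (x + s *: (y - x)).
  by case/andP: s01 => s0 s1; apply: interior_segment; rewrite ?(ltW s0).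
have mid := series_midpoint_concave (y - x) HG iz.
have small : \forall h \near (0 : R), `|h| < Num.min s (1 - s).
  by apply: nbhs0_lt; rewrite lt_min subr_gt0.
have [h h0 [[mid_h small_h] _]] := near0_pos (filterI mid small).
move: small_h; rewrite gtr0_norm// lt_min => /andP[hs hs1].
have {}mid : g (s + h) + g (s - h) <= 2 * g s.
  by move: mid_h; rewrite /g scalerDl scalerBl !addrA.
have f_plus : f s <= f (s + h) by apply: smin; rewrite in_itv /=; apply/andP; split; lra.
have f_minus : f s <= f (s - h) by apply: smin; rewrite in_itv /=; apply/andP; split; lra.
have : f (s + h) + f (s - h) = g (s + h) + g (s - h) - 2 * g s + 2 * f s - 2 * e * h ^+ 2.
  by rewrite /f; ring.
have : 0 < e * h ^+ 2 by rewrite mulr_gt0// exprn_gt0.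
lra.
Qed.

(** By concavity the chord from [x] to [y] lies below [G]. If it ended above the affine function at
    [y], it would exceed it already at points near [x], where the affine function dominates [G]. *)
Lemma series_supporting_affine G x m (b : R) : tropical_series Om G ->
  (region Om)° x -> G x = b + dotp m x ->
  (\forall y \near x, G y <= b + dotp m y) ->
  forall y, region Om y -> G y <= b + dotp m y.
Proof.
move=> HG ix Gx near_le y ry.
have small : \forall t \near (0 : R), `|t| < 1 by exact: nbhs0_lt.
have [t t0 [[+ tlt] _]] := near0_pos (filterI (near_line (y - x) near_le) small).
move: tlt; rewrite gtr0_norm// => t1.
have t01 : 0 <= t <= 1 by rewrite (ltW t0) (ltW t1).
move=> h2; have := le_trans (series_concave HG ix ry t01) h2.
rewrite Gx dotp_line dotpB => h.
rewrite -(ler_pM2l t0); lra.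
Qed.

End Concavity.

(** * Tropical interpolation *)

(* A tropical Cramer rule: [c j] is the tropical minor of [a] with column [j]
   deleted, so that [c j + a i j] expands the tropical determinant of [a] with
   row [i] repeated, and exchanging the two equal rows exhibits a second
   minimum. *)
Lemma tropical_interpolation (R : realDomainType) N
    (a : 'I_N -> 'I_N.+1 -> R) :
  exists c : 'I_N.+1 -> R, forall i, exists j j',
    [/\ j != j', c j + a i j = c j' + a i j'
      & forall l, c j + a i j <= c l + a i l].
Proof.
(* Row [ord_max] is virtual: a permutation sending it to [j] matches the [N] actual rows with the
   columns other than [j], and [S] is the corresponding term of the minor. *)
pose w (i : 'I_N) : 'I_N.+1 := lift ord_max i.
pose S (s : {perm 'I_N.+1}) : R := \sum_(i < N) a i (s (w i)).
have hasc j : exists c : R, (exists2 s : {perm 'I_N.+1}, s ord_max = j & S s = c) /\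
    forall s : {perm 'I_N.+1}, s ord_max = j -> c <= S s.
  have Pj : (tperm ord_max j : {perm 'I_N.+1}) ord_max == j by rewrite tpermL.
  case: (@Order.TotalTheory.arg_minP _ _ _ (tperm ord_max j)
    (fun s : {perm 'I_N.+1} => s ord_max == j) S Pj) => s /eqP sj smin.
  exists (S s); split; first by exists s.
  by move=> s' s'j; apply: smin; rewrite s'j.
pose c j := projT1 (cid (hasc j)).
have c_attained j : exists2 s : {perm 'I_N.+1}, s ord_max = j & S s = c j.
  by rewrite /c; case: cid => ? [].
have c_le (s : {perm 'I_N.+1}) : c (s ord_max) <= S s.
  by rewrite /c; case: cid => ? [_ H] /=; exact: H.
exists c => i.
pose T (s : {perm 'I_N.+1}) := S s + a i (s ord_max).
case: (@Order.TotalTheory.arg_minP _ _ _ (1%g : {perm 'I_N.+1}) xpredT T isT)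
  => s _ smin.
have T_le l : T s <= c l + a i l.
  have [s' <- <-] := c_attained l; exact: smin.
have eqT (s' : {perm 'I_N.+1}) : T s' = T s ->
    c (s' ord_max) + a i (s' ord_max) = T s.
  by move=> Ts'; apply/eqP; rewrite eq_le T_le -Ts' lerD2r c_le.
pose s' := (tperm ord_max (w i) * s)%g.
have s'max : s' ord_max = s (w i) by rewrite permM tpermL.
have s'w : s' (w i) = s ord_max by rewrite permM tpermR.
have Ts' : T s' = T s.
  rewrite /T /S (bigD1 i)//= [in RHS](bigD1 i)//= s'max s'w.
  rewrite (eq_bigr (fun l => a l (s (w l)))); first by ring.
  move=> l li; rewrite permM tpermD//; first exact: neq_lift.
  by rewrite (inj_eq lift_inj) eq_sym.
exists (s ord_max), (s (w i)); split.
- by rewrite (inj_eq perm_inj) neq_lift.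
- by rewrite -s'max !eqT.
- by move=> l; rewrite eqT.
Qed.

(** * Finite minima of affine functions *)

Section TropicalPolynomials.
Variable R : realType.
Implicit Types (x y : R * R) (m : int * int) (t : (int * int) * R).

Definition aff t x : R := t.2 + dotp t.1 x.

Definition tropical_poly t0 (s : seq ((int * int) * R)) x : R :=
  foldr (fun t v => Num.min (aff t x) v) (aff t0 x) s.

Lemma tropical_poly_le t0 s t x : t \in t0 :: s ->
  tropical_poly t0 s x <= aff t x.
Proof.
elim: s => [|u s IH]; first by rewrite inE => /eqP ->.
rewrite !inE /= => /or3P[/eqP tt0|/eqP ->|ts]; rewrite ge_min ?lexx//.
- by rewrite IH ?orbT// inE tt0 eqxx.
- by rewrite IH ?orbT// inE ts orbT.
Qed.

Lemma tropical_poly_attained t0 s x :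
  exists2 t, t \in t0 :: s & tropical_poly t0 s x = aff t x.
Proof.
elim: s => [|u s [t ts IH]]; first by exists t0; rewrite ?inE.
rewrite /= -/(tropical_poly t0 s x) minEle IH; case: ifP => _.
- by exists u; rewrite ?inE ?eqxx ?orbT.
- exists t => //; move: ts; rewrite !inE => /orP[->//|->].
  by rewrite !orbT.
Qed.

Lemma continuous_tropical_poly t0 s : continuous (tropical_poly t0 s).
Proof.
elim: s => [|u s IH] x; first exact: continuous_affine.
apply: (@continuous_min R (R * R)%type (aff u) (tropical_poly t0 s) x).
  exact: continuous_affine.
exact: IH.
Qed.

End TropicalPolynomials.

(** * Coefficients by concave conjugation *)

Section ConjugateCoefficients.
Variables (R : realType) (Om : halfplanes R).
Hypothesis HOm : bounded_rational_polygon Om.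
Implicit Types (x y : R * R) (m : int * int) (F : R * R -> R).

(** Up to sign a Legendre transform: the least [b] for which [b + dotp m] dominates [F] on the
    polygon, when there is one. It depends on the slope only, as [locally_min_at] demands, even if a
    list of monomials repeats a slope with different constants. *)
Definition conj_coef F m : R :=
  sup [set F y - dotp m y | y in region Om].

Lemma region_nonempty : region Om !=set0.
Proof.
by have [x ix] := polygon_interior HOm; exists x; exact: interior_subset ix.
Qed.

Lemma conj_coef_le F m (b : R) :
  (forall y, region Om y -> F y <= b + dotp m y) -> conj_coef F m <= b.
Proof.
move=> H; apply: ge_sup.
  by have [x rx] := region_nonempty; exists (F x - dotp m x), x.
by move=> _ [y ry <-]; rewrite lerBlDr; exact: H.
Qed.

Lemma le_conj_coef F m (b : R) x :
  (forall y, region Om y -> F y <= b + dotp m y) -> region Om x ->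
  F x <= conj_coef F m + dotp m x.
Proof.
move=> H rx; rewrite -lerBlDr; apply: sup_upper_bound; last by exists x.
split; first by exists (F x - dotp m x), x.
by exists b => _ [y ry <-]; rewrite lerBlDr; exact: H.
Qed.

Lemma tropical_poly_locally_min t0 s x :
  let F := tropical_poly t0 s in
  (region Om)° x ->
  locally_min_at F x [seq t.1 | t <- t0 :: s] (conj_coef F).
Proof.
move=> F ix; apply: filterS ix => y ry; split.
  move=> m /mapP[t ts ->]; apply: (@le_conj_coef F t.1 t.2) => // z _.
  exact: tropical_poly_le.
have [t ts Fy] := tropical_poly_attained t0 s y.
exists t.1; first exact: map_f.
apply/eqP; rewrite eq_le (@le_conj_coef F t.1 t.2)//=; last first.
  by move=> z _; exact: tropical_poly_le.
rewrite /F Fy /aff lerD2r; apply: conj_coef_le => z _.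
exact: tropical_poly_le.
Qed.

Lemma tropical_poly_conj_coef t0 s t x :
  let F := tropical_poly t0 s in
  t \in t0 :: s -> region Om x -> F x = aff t x ->
  F x = conj_coef F t.1 + dotp t.1 x.
Proof.
move=> F ts rx Fx; have Ft z : region Om z -> F z <= t.2 + dotp t.1 z.
  by move=> _; exact: tropical_poly_le.
apply/eqP; rewrite eq_le (le_conj_coef Ft)//= Fx lerD2r.
exact: conj_coef_le.
Qed.

Lemma tropical_poly_series t0 s :
  (forall t x, t \in t0 :: s -> region Om x -> 0 <= aff t x) ->
  (forall x, region Om x -> ~ (region Om)° x ->
    exists2 t, t \in t0 :: s & aff t x = 0) ->
  tropical_series Om (tropical_poly t0 s).
Proof.
move=> ge0 bd0.
have poly_ge0 x : region Om x -> 0 <= tropical_poly t0 s x.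
  by move=> rx; have [t ts ->] := tropical_poly_attained t0 s x; exact: ge0.
split => //.
- exact: continuous_subspaceT (@continuous_tropical_poly R t0 s).
- move=> x rx nix; have [t ts tx] := bd0 x rx nix.
  by apply/eqP; rewrite eq_le poly_ge0// andbT -tx tropical_poly_le.
- move=> x ix; exists [seq t.1 | t <- t0 :: s], (conj_coef (tropical_poly t0 s)).
  exact: tropical_poly_locally_min.
Qed.

Lemma tropical_poly_corner t0 s t t' x :
  let F := tropical_poly t0 s in
  t \in t0 :: s -> t' \in t0 :: s -> t.1 <> t'.1 -> (region Om)° x ->
  F x = aff t x -> F x = aff t' x -> corner_locus Om F x.
Proof.
move=> F ts ts' tt' ix Ft Ft'; have rx := interior_subset ix.
split=> //; exists [seq t.1 | t <- t0 :: s], (conj_coef F).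
split; first exact: tropical_poly_locally_min.
exists t.1, t'.1; split=> //; try exact: map_f;
  exact: tropical_poly_conj_coef.
Qed.

End ConjugateCoefficients.

(** * A competitor with slopes of order the square root of [N] *)

Lemma nat_sqrt_bounds (N : nat) : exists q, (q * q <= N < q.+1 * q.+1)%N.
Proof.
elim: N => [|N [q /andP[qN Nq]]]; first by exists 0%N.
have [lt|ge] := ltnP N.+1 (q.+1 * q.+1)%N.
  by exists q; rewrite (leq_trans qN).
have -> : N.+1 = (q.+1 * q.+1)%N by apply/eqP; rewrite eqn_leq Nq ge.
by exists q.+1; rewrite leqnn ltn_mul.
Qed.

Section Competitor.
Variables (R : realType) (Om : halfplanes R).
Hypothesis HOm : bounded_rational_polygon Om.
Implicit Types (x y : R * R) (m : int * int).

Lemma lam_lower_bound (K : set (R * R)) : compact K ->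
  K `<=` (region Om)° ->
  exists2 d : R, 0 < d & forall x r, K x -> d <= @lam R Om r x.
Proof.
move=> cK Kin; have [K0|/set0P Kn] := eqVneq K set0.
  by exists 1 => // x r; rewrite K0.
have dr (r : 'I_(nsides Om)) :
    exists d : R, 0 < d /\ forall x, K x -> d <= lam r x.
  have [|c cK' cmin] := compact_EVT_min (f := @lam R Om r) Kn cK.
    exact: continuous_subspaceT (@continuous_lam R Om r).
  exists (lam r c); split.
    by have /(interiorP HOm) := Kin _ (set_mem cK'); apply.
  by move=> x Kx; apply: cmin; rewrite inE.
pose d r := projT1 (cid (dr r)).
have dP r : 0 < d r /\ forall x, K x -> d r <= lam r x.
  by rewrite /d; case: cid.
exists (\big[Num.min/1]_r d r).
  by apply: lt_bigmin => // r _; exact: (dP r).1.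
move=> x r Kx; apply: (le_trans (bigmin_le _ r _)); exact: (dP r).2.
Qed.

(** Each of the two coordinates contributes at most [2 * (q * B)]. *)
Lemma dotp_diff_le m (q B : R) x y :
  `|m.1%:~R| <= q -> `|m.2%:~R| <= q ->
  `|x.1| <= B -> `|x.2| <= B -> `|y.1| <= B -> `|y.2| <= B ->
  dotp m x <= dotp m y + 4 * (q * B).
Proof.
move=> m1 m2 x1 x2 y1 y2.
have bound (a u v : R) : `|a| <= q -> `|u| <= B -> `|v| <= B ->
    a * u <= a * v + 2 * (q * B).
  move=> aq uB vB; rewrite -lerBlDl -mulrBr; apply: (le_trans (ler_norm _)).
  rewrite normrM mulrCA ler_pM//; apply: (le_trans (ler_normB _ _)).
  by rewrite mulr_natl mulr2n lerD.
have := bound _ _ _ m1 x1 y1; have := bound _ _ _ m2 x2 y2.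
rewrite /dotp; lra.
Qed.

(* Monomials with exponents in [{0..q}^2], where [q = floor (sqrt N)], are
   numerous enough to interpolate [N] points; their minimum varies by O(q) on
   the polygon, so the boundary terms [k lam] with [k = O(q)] do not interfere
   with it on [K]. *)
Lemma exists_bounded_slope_series (K : set (R * R)) : compact K ->
  K `<=` (region Om)° ->
  exists T : nat, forall (N : nat) (P : set (R * R)),
    (1 <= N)%N -> P `<=` K -> (P #= `I_N)%card ->
    exists k : nat, (k%:R <= T%:R * Num.sqrt N%:R :> R) /\
    exists G : R * R -> R, [/\ tropical_series Om G, P `<=` corner_locus Om G &
      forall r x, G x <= k%:R * @lam R Om r x].
Proof.
move=> cK Kin.
have [d d0 Kd] := lam_lower_bound cK Kin.
have [B B0 HB] := region_bounded HOm.
(* On [K] the lowest monomial will be at most [8 * q * B], whereas [k * lam r >= q * T * d]; this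
   choice of [T] separates the two for every [q > 0]. *)
pose T := Num.bound (8 * B / d).
have Td : 8 * B < T%:R * d.
  by rewrite -ltr_pdivrMr// archi_boundP// divr_ge0 ?mulr_ge0 ?(ltW d0) ?(ltW B0).
exists T => N P N1 PK cardP.
have [q /andP[qN Nq]] := nat_sqrt_bounds N.
have q0 : (0 < q)%N by case: q qN Nq => // _; rewrite ltnNge N1.
have [p pbij] : exists p : nat -> R * R, set_bij `I_N P p.
  by apply/card_set_bijP; rewrite card_eq_sym.
have Pp (i : 'I_N) : P (p i) by apply: (set_bij_sub pbij); exists (val i) => /=.
have pP x : P x -> exists i : 'I_N, p i = x.
  by move=> /(set_bij_surj pbij)[i /= iN <-]; exists (Ordinal iN).
exists (q * T)%N; split.
  rewrite natrM mulrC ler_wpM2l// -(ger0_norm (ler0n _ q)) -sqrtr_sqr ler_sqrt//.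
  by rewrite -natrX ler_nat -mulnn.
pose k : R := (q * T)%:R.
(* The index [j <= N < (q + 1)^2] is written with two digits in base [q + 1], which are the
   exponents. *)
pose mon (j : 'I_N.+1) : int * int := ((j %% q.+1)%N%:Z, (j %/ q.+1)%N%:Z).
have mon_inj : injective mon.
  move=> i j [mij dij].
  by apply: val_inj; rewrite /= (divn_eq i q.+1) (divn_eq j q.+1) mij dij.
have mon1 j : `|(mon j).1%:~R| <= q%:R :> R.
  by rewrite /= normr_nat ler_nat -ltnS ltn_mod.
have mon2 j : `|(mon j).2%:~R| <= q%:R :> R.
  rewrite /= normr_nat ler_nat -ltnS ltn_divLR//.
  by rewrite (leq_ltn_trans _ Nq)// -ltnS.
have [c Hc] := tropical_interpolation (fun (i : 'I_N) j => dotp (mon j) (p i)).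
have i0 : 'I_N := Ordinal N1.
have [l0 [_ [_ _ l0min]]] := Hc i0.
(* A common shift preserves the ties. With this one the lowest monomial at [p i0] has value
   [4 * q * B]; as a monomial varies by at most that much on the polygon, all of them stay
   nonnegative. *)
pose h := 4 * (q%:R * B) - (c l0 + dotp (mon l0) (p i0)).
pose tm j : (int * int) * R := (mon j, c j + h).
pose tb r : (int * int) * R :=
  (((q * T)%N%:Z * (@normal R Om r).1, (q * T)%N%:Z * (normal r).2),
   k * offset r).
have tbE r x : aff (tb r) x = k * lam r x.
  by rewrite /aff /lam /dotp /= !intrM -!pmulrn -/k; ring.
have rP (i : 'I_N) : region Om (p i) by apply: interior_subset; exact: (Kin _ (PK _ (Pp i))).
pose s := [seq tm j | j <- enum 'I_N.+1] ++ [seq tb r | r <- enum 'I_(nsides Om)].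
pose G := tropical_poly (tm ord0) s.
have tms j : tm j \in tm ord0 :: s.
  by rewrite inE mem_cat map_f ?mem_enum// orbT.
have tbs r : tb r \in tm ord0 :: s.
  by rewrite inE mem_cat [X in _ || (_ || X)]map_f ?mem_enum// !orbT.
have sP t : t \in tm ord0 :: s -> (exists j, t = tm j) \/ (exists r, t = tb r).
  rewrite inE mem_cat => /or3P[/eqP ->|/mapP[j _ ->]|/mapP[r _ ->]].
  - by left; exists ord0.
  - by left; exists j.
  - by right; exists r.
have var j x y : region Om x -> region Om y ->
    dotp (mon j) x <= dotp (mon j) y + 4 * (q%:R * B).
  move=> rx ry; have [x1 x2] := HB _ rx; have [y1 y2] := HB _ ry.
  by apply: dotp_diff_le; rewrite ?mon1 ?mon2.
have tm_ge0 j x : region Om x -> 0 <= aff (tm j) x.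
  move=> rx; have := var j _ _ (rP i0) rx; have := l0min j.
  rewrite /aff /= /h; lra.
have tm_lt (i : 'I_N) r : aff (tm l0) (p i) < aff (tb r) (p i).
  rewrite tbE; apply: (@le_lt_trans _ _ (8 * (q%:R * B))).
    have := var l0 _ _ (rP i) (rP i0); rewrite /aff /= /h; lra.
  have kd : k * d <= k * lam r (p i) by rewrite ler_wpM2l//; exact: (Kd _ r (PK _ (Pp i))).
  apply: (lt_le_trans _ kd); rewrite /k natrM -mulrA mulrCA.
  by rewrite ltr_pM2l ?ltr0n.
exists G; split.
- apply: (tropical_poly_series HOm).
    move=> t x /sP[[j ->]|[r ->]] rx; first exact: tm_ge0.
    by rewrite tbE mulr_ge0//; exact: rx.
  move=> x rx nix; have [r lr0] := boundary_lam0 HOm rx nix.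
  by exists (tb r); [exact: tbs|rewrite tbE lr0 mulr0].
- move=> _ /pP[i <-]; have [j [j' [jj' ejj' jmin]]] := Hc i.
  have Gj : G (p i) = aff (tm j) (p i).
    apply/eqP; rewrite eq_le tropical_poly_le//= /G.
    have [t /sP[[l ->]|[r ->]] ->] := tropical_poly_attained (tm ord0) s (p i).
      by have := jmin l; rewrite /aff /=; lra.
    apply: ltW; apply: le_lt_trans (tm_lt i r).
    by have := jmin l0; rewrite /aff /=; lra.
  apply: (@tropical_poly_corner _ _ HOm _ _ (tm j) (tm j')) => //=.
  + by move=> /mon_inj /eqP; apply/negP.
  + exact: (Kin _ (PK _ (Pp i))).
  + by rewrite -/G Gj /aff /=; lra.
- by move=> r x; rewrite -tbE; apply: tropical_poly_le.
Qed.

End Competitor.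

(** * The relaxation as a minimum of affine functions *)

Definition int_ball (M : nat) : seq int :=
  [seq i%:Z - M%:Z | i <- iota 0 (2 * M).+1].

Lemma mem_int_ball M (z : int) : (z \in int_ball M) = (`|z| <= M)%N.
Proof.
apply/mapP/idP => [[i]|zM]; first by rewrite mem_iota => + ->; lia.
by exists (absz (z + M%:Z)); rewrite ?mem_iota; lia.
Qed.

Definition exponents (M : nat) : seq (int * int) :=
  [seq (a, b) | a <- int_ball M, b <- int_ball M].

Lemma mem_exponents M (m : int * int) :
  (m \in exponents M) = (`|m.1| <= M)%N && (`|m.2| <= M)%N.
Proof.
apply/allpairsP/andP => [[[a b]]|[m1 m2]] /=.
  by rewrite !mem_int_ball => -[aM bM ->].
by exists m; rewrite !mem_int_ball m1 m2 -surjective_pairing.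
Qed.

Section Relaxation.
Variables (R : realType) (Om : halfplanes R).
Hypothesis HOm : bounded_rational_polygon Om.
Implicit Types (x y : R * R) (m : int * int) (F G : R * R -> R).

(** In contrast with [locally_min_at], one list and one coefficient function serve the whole
    polygon, boundary included. The length and area bounds see [F] through this representation. *)
Definition min_rep F (A : seq (int * int)) (c : int * int -> R) :=
  forall x, region Om x ->
    (forall m, m \in A -> F x <= c m + dotp m x) /\
    (exists2 m, m \in A & F x = c m + dotp m x).

Variables (L k : nat).
Hypothesis normal_le : forall r : 'I_(nsides Om),
  (`|(normal r).1| <= L)%N /\ (`|(normal r).2| <= L)%N.

(** [slope_le_exit] in the two coordinate directions and their opposites bounds both coordinates of
    [m] from above and below. *)
Lemma exponent_bound m (b : R) x : (region Om)° x ->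
  (forall y, region Om y -> 0 <= b + dotp m y) ->
  (forall r, b + dotp m x <= k%:R * @lam R Om r x) ->
  m \in exponents (k * L).
Proof.
move=> ix ge0 lek.
have slope (u : R * R) : u <> 0 -> exists r, dotp m u <= k%:R * dotp (@normal R Om r) u.
  by move=> u0; exact: (slope_le_exit HOm ix u0 ge0 lek).
have int_le (a : int) (n : int) : (`|n| <= L)%N ->
    a%:~R <= k%:R * n%:~R :> R -> a <= (k * L)%N%:Z.
  move=> nL; rewrite pmulrn -intrM ler_int => aN; apply: (le_trans aN); nia.
have e1 : (1, 0) <> 0 :> R * R by case => /eqP; rewrite oner_eq0.
have e2 : (0, 1) <> 0 :> R * R by case => /eqP; rewrite oner_eq0.
have n1 : (-1, 0) <> 0 :> R * R by case => /eqP; rewrite oppr_eq0 oner_eq0.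
have n2 : (0, -1) <> 0 :> R * R by case => /eqP; rewrite oppr_eq0 oner_eq0.
have [r1] := slope _ e1; have [r2] := slope _ e2.
have [r3] := slope _ n1; have [r4] := slope _ n2.
rewrite /dotp /= !(mulr0, mulr1, mulrN1, addr0, add0r) -!rmorphN /=.
have [h1 _] := normal_le r1; have [_ h2] := normal_le r2.
have [h3 _] := normal_le r3; have [_ h4] := normal_le r4.
move=> /int_le H4 /int_le H3 /int_le H2 /int_le H1.
rewrite mem_exponents; apply/andP; split.
- by have := H1 h1; have := H3; rewrite abszN => /(_ h3); lia.
- by have := H2 h2; have := H4; rewrite abszN => /(_ h4); lia.
Qed.

Variables (P : set (R * R)) (G0 : R * R -> R).
Hypothesis G0_series : tropical_series Om G0.
Hypothesis G0_corner : P `<=` corner_locus Om G0.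
Hypothesis G0_le : forall r x, G0 x <= k%:R * @lam R Om r x.
Let F := relaxation Om P.

Lemma relaxation_le G x : tropical_series Om G -> P `<=` corner_locus Om G ->
  region Om x -> F x <= G x.
Proof.
move=> HG PG rx; apply: ge_inf; last by exists G.
by exists 0 => _ [G' [HG' _] <-]; exact: series_ge0 HG' _ rx.
Qed.

Lemma relaxation_ge0 x : region Om x -> 0 <= F x.
Proof.
move=> rx; apply: lb_le_inf; first by exists (G0 x), G0.
by move=> _ [G [HG _] <-]; exact: series_ge0 HG _ rx.
Qed.

Lemma relaxation_le_lam (r : 'I_(nsides Om)) x : region Om x -> F x <= k%:R * lam r x.
Proof. by move=> rx; apply: (le_trans (relaxation_le G0_series G0_corner rx)). Qed.

(** Makes every [conj_coef] of the relaxation a supremum of a bounded set: [F] lies below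
    [k * lam r] for some side, and affine functions are bounded on the polygon. *)
Lemma relaxation_has_conj m : exists b : R,
  forall y, region Om y -> F y <= b + dotp m y.
Proof.
have [B B0 HB] := region_bounded HOm.
have [x rx] := region_nonempty HOm.
have [r _] : exists r : 'I_(nsides Om), True.
  have u0 : (1, 0) <> 0 :> R * R by case => /eqP; rewrite oner_eq0.
  by have [r _] := exists_exit_normal HOm rx u0; exists r.
pose q : R := `|m.1%:~R| + `|m.2%:~R|.
pose Q : R := `|(normal r).1%:~R| + `|(normal r).2%:~R|.
exists (k%:R * (4 * (Q * B) + lam r x) + 4 * (q * B) - dotp m x) => y ry.
have [x1 x2] := HB _ rx; have [y1 y2] := HB _ ry.
have /= H1 := @dotp_diff_le R m q B x y _ _ x1 x2 y1 y2.
have /= H2 := @dotp_diff_le R (normal r) Q B y x _ _ y1 y2 x1 x2.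
have {}H1 : dotp m x <= dotp m y + 4 * (q * B).
  by apply: H1; rewrite /q ?lerDl ?lerDr.
have {}H2 : lam r y <= 4 * (Q * B) + lam r x.
  suff: dotp (normal r) y <= dotp (normal r) x + 4 * (Q * B) by rewrite /lam; lra.
  by apply: H2; rewrite /Q ?lerDl ?lerDr.
have := relaxation_le_lam r ry.
have : k%:R * lam r y <= k%:R * (4 * (Q * B) + lam r x) by rewrite ler_wpM2l.
lra.
Qed.

(* At an interior point where a competitor does not exceed [G0], an affine
   function active there dominates it on the whole polygon by concavity, hence
   dominates the relaxation, and has its slope in [exponents (k * L)]. *)
Lemma relaxation_min_rep : min_rep F (exponents (k * L)) (conj_coef Om F).
Proof.
move=> x rx.
have le m : F x <= conj_coef Om F m + dotp m x.
  by have [b Fb] := relaxation_has_conj m; exact: le_conj_coef Fb rx.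
split=> [m _|]; first exact: le.
suff [m mA Fm] : exists2 m, m \in exponents (k * L) & conj_coef Om F m + dotp m x <= F x.
  by exists m => //; apply/eqP; rewrite eq_le le.
have [ix|nix] := pselect ((region Om)° x); last first.
  (* On the boundary the slope [k * normal r] works: [F <= k * lam r] everywhere bounds its
     coefficient by [k * offset r], and [lam r] vanishes at [x]. *)
  have [r lr0] := boundary_lam0 HOm rx nix.
  exists (k%:Z * (normal r).1, k%:Z * (normal r).2).
    by rewrite mem_exponents /=; have := normal_le r; nia.
  apply: (le_trans _ (relaxation_ge0 rx)).
  have E y : dotp (k%:Z * (normal r).1, k%:Z * (normal r).2) y = k%:R * dotp (normal r) y.
    by rewrite /dotp /= !intrM -!pmulrn; ring.
  have -> : 0 = k%:R * offset r + dotp (k%:Z * (normal r).1, k%:Z * (normal r).2) x.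
    by rewrite E -mulrDr -lamE lr0 mulr0.
  rewrite lerD2r; apply: (conj_coef_le HOm) => y ry.
  by rewrite E -mulrDr -lamE relaxation_le_lam.
pose h m := conj_coef Om F m + dotp m x.
have below G : tropical_series Om G -> P `<=` corner_locus Om G ->
    G x <= G0 x -> exists2 m, m \in exponents (k * L) & h m <= G x.
  move=> HG PG GG0; have [A [c Ac]] := series_local HG ix.
  have [_ [m mA Gm]] := nbhs_singleton Ac.
  have near_le : \forall y \near x, G y <= c m + dotp m y.
    by apply: filterS Ac => y [+ _]; apply.
  have Gle := series_supporting_affine HOm HG ix Gm near_le.
  exists m.
    apply: (exponent_bound ix (b := c m)).
      by move=> y ry; apply: (le_trans (series_ge0 HG ry)); exact: Gle.
    by move=> r; rewrite -Gm (le_trans GG0).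
  rewrite /h Gm lerD2r; apply: (conj_coef_le HOm) => y ry.
  by apply: (le_trans (relaxation_le HG PG ry)); exact: Gle.
have [m0 m0A _] := below _ G0_series G0_corner (lexx _).
(* The slope found by [below] depends on the competitor. Since it comes from a finite list, the
   lowest [h m] over the list lies below all competitors at once, hence below their infimum; a
   competitor above [G0] at [x] is compared through [G0]. *)
have [m mA mmin] : exists2 m, m \in exponents (k * L) &
    forall m', m' \in exponents (k * L) -> h m <= h m'.
  have : exponents (k * L) != [::] by move: m0A; case: exponents.
  elim: (exponents _) => // a s IH _.
  have [->|s0] := eqVneq s [::].
    by exists a; rewrite ?inE// => m'; rewrite inE => /eqP ->.
  have [m ms mmin] := IH s0; have [am|ma] := leP (h a) (h m).
    exists a; first by rewrite inE eqxx.
    by move=> m'; rewrite inE => /orP[/eqP ->//|/mmin]; exact: le_trans.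
  exists m; first by rewrite inE ms orbT.
  by move=> m'; rewrite inE => /orP[/eqP ->|/mmin//]; exact: ltW.
exists m => //; apply: lb_le_inf; first by exists (G0 x), G0.
move=> _ [G [HG PG] <-]; have [GG0|/ltW G0G] := leP (G x) (G0 x).
  by have [m' m'A hm'] := below G HG PG GG0; apply: le_trans hm'; exact: mmin.
have [m' m'A hm'] := below _ G0_series G0_corner (lexx _).
by apply: le_trans G0G; apply: le_trans hm'; exact: mmin.
Qed.

End Relaxation.

(** * Multiplicities of the sides *)

Lemma near_all_seq (X : topologicalType) (T : eqType) (s : seq T)
    (Q : T -> X -> Prop) (x : X) :
  (forall t, t \in s -> \forall y \near x, Q t y) ->
  \forall y \near x, forall t, t \in s -> Q t y.
Proof.
elim: s => [|a s IH] H; first by apply: filterE.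
have Ha := H a (mem_head _ _).
have Hs := IH (fun t ts => H t (mem_behead (s := a :: s) ts)).
apply: filterS2 Ha Hs => y Qa Qs t; rewrite inE => /orP[/eqP -> //|].
exact: Qs.
Qed.

Lemma orthogonal_parallel (R : idomainType) (n1 n2 a1 a2 b1 b2 : R) :
  (n1, n2) <> (0, 0) -> n1 * a1 + n2 * a2 = 0 -> n1 * b1 + n2 * b2 = 0 ->
  a1 * b2 = a2 * b1.
Proof.
move=> n0 ha hb.
have h1 : n1 * (a1 * b2 - a2 * b1) = 0.
  have -> : n1 * (a1 * b2 - a2 * b1) = b2 * (n1 * a1 + n2 * a2) - a2 * (n1 * b1 + n2 * b2) by ring.
  by rewrite ha hb !mulr0 subr0.
have h2 : n2 * (a1 * b2 - a2 * b1) = 0.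
  have -> : n2 * (a1 * b2 - a2 * b1) = a1 * (n1 * b1 + n2 * b2) - b1 * (n1 * a1 + n2 * a2) by ring.
  by rewrite ha hb !mulr0 subr0.
move/eqP: h1; rewrite mulf_eq0 => /orP[/eqP n10|]; last by rewrite subr_eq0 => /eqP.
move/eqP: h2; rewrite mulf_eq0 => /orP[/eqP n20|]; last by rewrite subr_eq0 => /eqP.
by case: n0; rewrite n10 n20.
Qed.

Lemma collinear_scale (R : realFieldType) (d w : R * R) : w <> 0 ->
  d.1 * w.2 = d.2 * w.1 ->
  d = ((d.1 * w.1 + d.2 * w.2) / (w.1 ^+ 2 + w.2 ^+ 2)) *: w.
Proof.
move=> w0 par; set W := w.1 ^+ 2 + w.2 ^+ 2.
have W0 : W != 0.
  rewrite paddr_eq0 ?sqr_ge0// !sqrf_eq0; apply/negP => /andP[/eqP w1 /eqP w2].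
  by apply: w0; rewrite [w]surjective_pairing w1 w2.
rewrite [LHS]surjective_pairing [RHS]surjective_pairing; congr pair.
  apply: (mulIf W0); rewrite /= /GRing.scale /= [RHS]mulrAC divfK// /W.
  transitivity (d.1 * w.1 ^+ 2 + (d.1 * w.2) * w.2); first by ring.
  by rewrite par; ring.
apply: (mulIf W0); rewrite /= /GRing.scale /= [RHS]mulrAC divfK// /W.
transitivity ((d.2 * w.1) * w.1 + d.2 * w.2 ^+ 2); first by ring.
by rewrite -par; ring.
Qed.

Section BoundaryDegree.
Variables (R : realType) (Om : halfplanes R).
Hypothesis HOm : bounded_rational_polygon Om.
Implicit Types (x y : R * R) (m : int * int) (r : 'I_(nsides Om)).

Lemma normalR_neq0 r : ((normal r).1%:~R, (normal r).2%:~R) <> (0, 0) :> R * R.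
Proof.
case=> /eqP + /eqP; rewrite !intr_eq0 => /eqP n1 /eqP n2.
by apply: (normal_neq0 HOm (r := r)); rewrite [normal r]surjective_pairing n1 n2.
Qed.

Lemma side_relint_nonempty r : side_relint r !=set0.
Proof.
have [p [q [[lp rp] [lq rq] pq]]] := side_nondegenerate HOm r.
pose w := q - p.
have nw : dotp (normal r) w = 0 by move: lp lq; rewrite dotpB /lam; lra.
pose W := w.1 ^+ 2 + w.2 ^+ 2.
have w0 : w <> 0 by move/eqP; rewrite subr_eq0 eq_sym => /eqP.
have W0 : W != 0.
  rewrite paddr_eq0 ?sqr_ge0// !sqrf_eq0; apply/negP => /andP[/eqP w1 /eqP w2].
  by apply: w0; rewrite [w]surjective_pairing w1 w2.
(* Coordinate of the projection to the line through [p] and [q], 0 at [p] and 1 at [q]; a point of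
   that line with [0 < s y < 1] lies on the segment. The relative interior point is the midpoint. *)
pose s y : R := ((y.1 - p.1) * w.1 + (y.2 - p.2) * w.2) / W.
pose x := p + 2^-1 *: w.
exists x; split.
  split; first by rewrite lam_line nw lp mulr0 addr0.
  by apply: region_segment => //; apply/andP; split; lra.
have sx : s x = 2^-1.
  have -> : s x = 2^-1 * (W / W) by rewrite /s /W /x /= /GRing.scale /=; ring.
  by rewrite divff// mulr1.
have cs : {for x, continuous s}.
  apply: cvgM; last exact: cvg_cst.
  apply: cvgD; apply: cvgM; try exact: cvg_cst;
    (apply: cvgB; last exact: cvg_cst); [exact: cvg_fst|exact: cvg_snd].
have near01 : \forall y \near x, 0 < s y < 1.
  have H : \forall z \near s x, 0 < z < 1.
    rewrite sx; near=> z; apply/andP; split; near: z.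
      by apply: lt_nbhsr; lra.
    by apply: lt_nbhsl; lra.
  exact: (cs _ H).
apply: filterS near01 => y /andP[s0 s1] ly.
have ny : dotp (normal r) (y - p) = 0 by move: lp ly; rewrite dotpB /lam; lra.
have par : (y.1 - p.1) * w.2 = (y.2 - p.2) * w.1 :=
  orthogonal_parallel (@normalR_neq0 r) ny nw.
have -> : y = p + s y *: w by rewrite -(@collinear_scale _ (y - p) w w0 par) addrC subrK.
by apply: region_segment => //; rewrite !ltW.
Unshelve. all: by end_near. Qed.

Definition side_exponent r (j : nat) : int * int :=
  (j%:Z * (normal r).1, j%:Z * (normal r).2).

Lemma side_exponentE r j x :
  j%:R * offset r + dotp (side_exponent r j) x = j%:R * lam r x.
Proof. by rewrite /lam /dotp /= !intrM -!pmulrn; ring. Qed.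

(** Nonnegative on both sides of a zero inside the side, the affine function is constant along it,
    so [m] is parallel to the normal. Primitivity makes the factor an integer, computed from Bezout
    coefficients, and positivity of [lam r] at an interior point of the polygon gives its sign. *)
Lemma active_on_side r m (b : R) x : side_relint r x ->
  (forall y, region Om y -> 0 <= b + dotp m y) -> b + dotp m x = 0 ->
  exists j : nat, m = side_exponent r j /\ b = j%:R * offset r.
Proof.
move=> [[lx rx] near_x] ge0 x0.
pose n := normal r.
pose v : R * R := (- n.2%:~R, n.1%:~R).
have nv : dotp n v = 0 by rewrite /dotp /=; ring.
have [t t0 [rp rm]] := near0_pos (near_line v near_x).
have := ge0 _ (rp _); rewrite lam_line -/n nv lx mulr0 addr0 => /(_ erefl).
have := ge0 _ (rm _); rewrite lam_line -/n nv lx mulr0 addr0 => /(_ erefl).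
rewrite !dotp_line ![b + (dotp m x + _)]addrA x0 !add0r mulNr oppr_ge0 pmulr_rle0// pmulr_rge0//.
move=> h1 h2.
have mn : m.1 * n.2 = m.2 * n.1.
  have : dotp m v = 0 by apply/eqP; rewrite eq_le h1 h2.
  move=> h; apply/eqP; rewrite -(eqr_int R) !intrM; apply/eqP.
  by move: h; rewrite /dotp /=; lra.
have /coprimezP[[u w] /= uw] := normal_primitive HOm r.
pose j := u * m.1 + w * m.2.
have j1 : m.1 = j * n.1.
  transitivity ((u * n.1 + w * n.2) * m.1); first by rewrite uw mul1r.
  transitivity (u * n.1 * m.1 + w * (m.1 * n.2)); first by ring.
  by rewrite mn /j; ring.
have j2 : m.2 = j * n.2.
  transitivity ((u * n.1 + w * n.2) * m.2); first by rewrite uw mul1r.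
  transitivity (u * (m.2 * n.1) + w * n.2 * m.2); first by ring.
  by rewrite -mn /j; ring.
have mE y : dotp m y = j%:~R * dotp n y.
  by rewrite /dotp j1 j2 !intrM; ring.
have bE : b = j%:~R * offset r.
  by move: x0 lx; rewrite mE /lam -/n => h1' h2'; have -> : offset r = - dotp n x; lra.
have j0 : 0 <= j.
  have [z iz] := polygon_interior HOm.
  have := ge0 _ (interior_subset iz); rewrite mE bE -mulrDr -lamE.
  by rewrite pmulr_lge0 ?ler0z//; move/(interiorP HOm): iz; apply.
exists `|j|%N; rewrite /side_exponent gez0_abs// -j1 -j2 -surjective_pairing.
by split=> //; rewrite bE pmulrn gez0_abs.
Qed.

Variables (F : R * R -> R) (A : seq (int * int)) (c : int * int -> R) (k : nat).
Hypothesis F_rep : min_rep Om F A c.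
Hypothesis F_ge0 : forall x, region Om x -> 0 <= F x.
Hypothesis F_le : forall r x, region Om x -> F x <= k%:R * lam r x.

Lemma affine_ge0 m x : m \in A -> region Om x -> 0 <= c m + dotp m x.
Proof.
by move=> mA rx; apply: (le_trans (F_ge0 rx)); exact: (F_rep rx).1.
Qed.

(** An affine function of the representation that is positive at [x] exceeds [k * lam r], hence [F],
    near [x]. Only those vanishing at [x] remain, and they are multiples of [lam r], so the smallest
    multiple is [F]. *)
Lemma exists_side_mult r : exists j, is_side_mult F r j.
Proof.
have F0 x : side_relint r x -> F x = 0.
  move=> [[lx rx] _]; apply/eqP; rewrite eq_le F_ge0// andbT.
  by have := F_le r rx; rewrite lx mulr0.
(* The predicate does not mention a point, so its least solution is the same along the whole
   side. *)
pose p j := (side_exponent r j \in A) && (c (side_exponent r j) == j%:R * offset r).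
have [x0 x0r] := side_relint_nonempty r.
have exp : exists j, p j.
  have [_ [m mA Fm]] := F_rep x0r.1.2.
  have [j [mj cj]] := active_on_side x0r (fun y ry => affine_ge0 mA ry)
    (etrans (esym Fm) (F0 _ x0r)).
  by exists j; rewrite /p -mj mA cj eqxx.
case: (ex_minnP exp) => j /andP[jA /eqP cj] jmin.
exists j => x xr.
have near_A : \forall y \near x, forall m, m \in A ->
    c m + dotp m x = 0 \/ k%:R * lam r y < c m + dotp m y.
  apply: near_all_seq => m mA.
  have [e|ne] := eqVneq (c m + dotp m x) 0; first by apply: filterE; left.
  pose g y := c m + dotp m y - k%:R * lam r y.
  have gx : 0 < g x.
    rewrite /g xr.1.1 mulr0 subr0 lt_neqAle eq_sym ne.
    exact: affine_ge0 xr.1.2.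
  have cg : {for x, continuous g}.
    apply: cvgB; first exact: continuous_affine.
    by apply: cvgM; [exact: cvg_cst|exact: continuous_lam].
  have H : \forall z \near g x, 0 < z by exact: lt_nbhsr.
  have Hg : \forall y \near x, 0 < g y by exact: (cg _ H).
  by apply: filterS Hg => y; rewrite subr_gt0; right.
apply: filterS near_A => y Hy ry.
have [le [m mA Fm]] := F_rep ry.
have lj : F y <= j%:R * lam r y by rewrite -side_exponentE -cj; exact: le.
apply/eqP; rewrite eq_le lj /=.
have [mx|] := Hy m mA; last by rewrite -Fm ltNge F_le.
have [i [mi ci]] := active_on_side xr (fun z rz => affine_ge0 mA rz) mx.
rewrite Fm ci mi side_exponentE; apply: ler_wpM2r; first exact: ry.
by rewrite ler_nat; apply: jmin; rewrite /p -mi mA ci eqxx.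
Qed.

Lemma side_mult_bound r j : is_side_mult F r j -> (j <= k)%N.
Proof.
move=> Hj; have [x xr] := side_relint_nonempty r.
have [z iz] := polygon_interior HOm.
have small : \forall t \near (0 : R), `|t| < 1 by exact: nbhs0_lt.
have [t t0 [+ _]] := near0_pos (filterI (near_line (z - x) (Hj x xr)) small).
case=> Fj; rewrite gtr0_norm// => t1.
have rt : region Om (x + t *: (z - x)).
  apply: region_segment; [exact: xr.1.2|exact: interior_subset iz|].
  by rewrite !ltW.
have := F_le r rt; rewrite (Fj rt) lam_segment xr.1.1 mulr0 add0r.
rewrite ler_pM2r ?ler_nat// mulr_gt0//.
by move/(interiorP HOm): iz; apply.
Qed.

Lemma boundary_degree_le :
  (boundary_degree Om F <= ((nsides Om * k)%N%:R)%:E)%E.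
Proof.
have -> : ((nsides Om * k)%N%:R%:E = \sum_(r < nsides Om) k%:R%:E :> \bar R)%E.
  by rewrite sumEFin sumr_const card_ord -mulrnA mulnC.
apply: lee_sum => r _; rewrite /side_mult.
case: xgetP => [v _ [j Hj <-]|none].
  by rewrite lee_fin ler_nat; exact: side_mult_bound Hj.
have [j Hj] := exists_side_mult r; exfalso.
by apply: (none (j%:R%:E)); exists j.
Qed.

End BoundaryDegree.

(** * Slicing *)

(** Additivity of Lebesgue measure on disjoint open intervals inside [[-B, B]]. *)
Lemma sum_disjoint_intervals (R : realType) (T : choiceType) (s : seq T)
    (l r : T -> R) (B : R) : uniq s -> 0 <= B ->
  (forall e, e \in s -> [/\ - B <= l e, l e <= r e & r e <= B]) ->
  (forall e e' t, e \in s -> e' \in s ->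
    l e < t < r e -> l e' < t < r e' -> e = e') ->
  \sum_(e <- s) (r e - l e) <= 2 * B.
Proof.
move=> us B0 lr disj.
pose I e : set R := [set` `]l e, r e[].
pose mu := @lebesgue_measure R.
have muI e : e \in s -> mu (I e) = (r e - l e)%:E.
  move=> es; have [_ ler _] := lr e es.
  rewrite /mu lebesgue_measure_itv /= lte_fin -EFinB; case: ltP => // rl.
  by congr EFin; apply/eqP; rewrite eq_sym subr_eq0 eq_le rl.
have : (mu (\bigcup_(e in [set` s]) I e) <= mu [set` `[(- B)%R, B]])%E.
  apply: le_measure; rewrite ?inE.
  - by apply: fin_bigcup_measurable => [|e _]; [exact: finite_seq|exact: measurable_itv].
  - exact: measurable_itv.
  - move=> t [e /= es]; rewrite /I /= !in_itv /= => /andP[let_ ltr_].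
    have [Bl _ rB] := lr e es.
    by rewrite (le_trans Bl (ltW let_)) (le_trans (ltW ltr_) rB).
rewrite /mu measure_fin_bigcup.
- rewrite -fsbig_seq // (eq_big_seq _ muI) sumEFin.
  rewrite lebesgue_measure_itv /= lte_fin -EFinB opprK.
  case: ifP => _; rewrite lee_fin => /le_trans; apply; lra.
- exact: finite_seq.
- move=> e e' /= es es' [t []]; rewrite /I /= !in_itv /=.
  exact: disj.
- by move=> e _; exact: measurable_itv.
Qed.

Lemma sum_range_indicator (a b n : nat) :
  (\sum_(i < n) (a <= i < b) = minn b n - minn a n)%N.
Proof.
elim: n => [|n IH]; first by rewrite big_ord0 !minn0.
by rewrite big_ord_recr /= IH; lia.
Qed.

(** A discrete layer-cake formula: a jump is the number of levels in [[lo, hi)], the levels running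
    from [- M] to [M - 1]. It allows the sum over edges to be exchanged with a sum over levels. *)
Lemma int_length_sum (R : pzRingType) (M : nat) (lo hi : int) :
  - M%:Z <= lo -> lo <= hi -> hi <= M%:Z ->
  (hi - lo)%:~R = \sum_(i < 2 * M) (nat_of_bool (lo <= i%:Z - M%:Z < hi))%:R :> R.
Proof.
move=> Ml lh hM.
under eq_bigr => i _.
  have -> : (lo <= i%:Z - M%:Z < hi) = (absz (lo + M%:Z)%R <= i < absz (hi + M%:Z)%R)%N by lia.
  over.
rewrite -natr_sum sum_range_indicator pmulrn; congr (_ *~ _); lia.
Qed.

(* For a fixed integer [i], the pieces [S e] with [lo e <= i < hi e] meet every
   horizontal line in at most one point altogether, so their vertical
   projections do not overlap. *)
Lemma sum_slope_drop_height (R : realType) (T : choiceType) (s : seq T)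
    (S : T -> set (R * R)) (a b : T -> R * R) (lo hi : T -> int)
    (M : nat) (B : R) : uniq s -> 0 <= B ->
  (forall e, e \in s -> [/\ - M%:Z <= lo e, lo e <= hi e & hi e <= M%:Z]) ->
  (forall e, e \in s -> S e (a e) /\ S e (b e)) ->
  (forall e x, e \in s -> S e x -> `|x.2| <= B) ->
  (forall e x y t, e \in s -> S e x -> S e y -> 0 <= t <= 1 ->
    S e (x + t *: (y - x))) ->
  (forall e e' x y, e \in s -> e' \in s -> S e x -> S e' y ->
    x.2 = y.2 -> x.1 < y.1 -> hi e' <= lo e) ->
  (forall e e' x y, e \in s -> e' \in s -> S e x -> S e' x ->
    S e y -> S e' y -> x <> y -> e = e') ->
  \sum_(e <- s) (hi e - lo e)%:~R * `|(a e).2 - (b e).2| <=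
    4 * M%:R * B.
Proof.
move=> us B0 lohi Sab SB Sconv Smono Sdisj.
pose l e := Num.min (a e).2 (b e).2.
pose r e := Num.max (a e).2 (b e).2.
have lrE e : `|(a e).2 - (b e).2| = r e - l e.
  rewrite /r /l; case: (leP (a e).2 (b e).2) => ab.
    by rewrite ler0_norm ?subr_le0// opprB.
  by rewrite gtr0_norm ?subr_gt0.
have meet e t : e \in s -> l e < t < r e -> exists2 z, S e z & z.2 = t.
  move=> es /andP[lt tr]; have [Sa Sb] := Sab e es.
  have ab0 : (b e).2 - (a e).2 != 0.
    rewrite subr_eq0; apply/eqP => ab.
    by move: (lt_trans lt tr); rewrite /l /r ab minxx maxxx ltxx.
  pose u := (t - (a e).2) / ((b e).2 - (a e).2).
  have uE : u * ((b e).2 - (a e).2) = t - (a e).2 by rewrite divfK.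
  exists (a e + u *: (b e - a e)); last first.
    by rewrite /= /GRing.scale /= uE; ring.
  apply: Sconv => //; move: lt tr uE ab0; rewrite /l /r.
  case: (leP (a e).2 (b e).2) => ab lt tr uE ab0.
  - have ab' : 0 < (b e).2 - (a e).2 by rewrite lt_neqAle eq_sym ab0 subr_ge0.
    by apply/andP; split; rewrite -(ler_pM2r ab') uE ?mul0r ?mul1r; lra.
  - have ab' : (b e).2 - (a e).2 < 0 by rewrite subr_lt0.
    by apply/andP; split; rewrite -(ler_nM2r ab') uE ?mul0r ?mul1r; lra.
have -> : \sum_(e <- s) (hi e - lo e)%:~R * `|(a e).2 - (b e).2| =
    \sum_(i < 2 * M) \sum_(e <- s | lo e <= i%:Z - M%:Z < hi e) (r e - l e).
  rewrite (exchange_big_dep xpredT)//=; apply: eq_big_seq => e es.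
  have [Ml lh hM] := lohi e es.
  rewrite lrE (int_length_sum R Ml lh hM) mulr_suml [RHS]big_mkcond /=.
  by apply: eq_bigr => i _; case: ifP => _; rewrite ?mul1r ?mul0r.
have -> : 4 * M%:R * B = \sum_(i < 2 * M) (2 * B).
  rewrite sumr_const card_ord -[RHS]mulr_natl natrM; ring.
apply: ler_sum => i _; rewrite -big_filter.
apply: sum_disjoint_intervals => //; first exact: filter_uniq.
  move=> e; rewrite mem_filter => /andP[_ es]; have [Sa Sb] := Sab e es.
  have := SB _ _ es Sa; have := SB _ _ es Sb; rewrite !ler_norml.
  move=> /andP[b1 b2] /andP[a1 a2].
  by split; rewrite /l /r ?le_min ?ge_max ?a1 ?a2 ?b1 ?b2// le_max ge_min lexx.
move=> e e' t; rewrite !mem_filter => /andP[/andP[le_ he] es] /andP[/andP[le' he'] es'].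
have same_point t' : l e < t' < r e -> l e' < t' < r e' ->
    exists z, [/\ S e z, S e' z & z.2 = t'].
  move=> h h'; have [z Sz zt] := meet e t' es h.
  have [z' Sz' zt'] := meet e' t' es' h'.
  have zz : z.2 = z'.2 by rewrite zt.
  have [c|c|c] := ltgtP z.1 z'.1.
  - have := Smono _ _ _ _ es es' Sz Sz' zz c; lia.
  - have := Smono _ _ _ _ es' es Sz' Sz (esym zz) c; lia.
  - have E : z = z' by rewrite [z]surjective_pairing c zz -surjective_pairing.
    by exists z; split=> //; rewrite E.
(* Two pieces may cross at one point, so a second height in the common range supplies the second
   shared point needed to identify them. *)
move=> ht ht'; pose t' := (t + Num.min (r e) (r e')) / 2.
have [tr tr'] : t < r e /\ t < r e' by case/andP: ht; case/andP: ht'.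
have [lt lt'] : l e < t /\ l e' < t by case/andP: ht; case/andP: ht'.
have tm : t < Num.min (r e) (r e') by rewrite lt_min tr tr'.
have mr : Num.min (r e) (r e') <= r e by rewrite ge_min lexx.
have mr' : Num.min (r e) (r e') <= r e' by rewrite ge_min lexx orbT.
have tt' : t < t' by rewrite /t'; lra.
have h1 : l e < t' < r e by apply/andP; rewrite /t'; split; lra.
have h1' : l e' < t' < r e' by apply/andP; rewrite /t'; split; lra.
have [z [Sz Sz' zt]] := same_point t ht ht'.
have [w [Sw Sw' wt]] := same_point t' h1 h1'.
apply: (Sdisj e e' z w) => // zw.
by move: tt'; rewrite -zt -wt zw ltxx.
Qed.

(** * Euclidean norm and diameter *)

Section EuclideanNorm.
Variable R : realType.
Implicit Types (x y v : R * R) (m : int * int) (S : set (R * R)).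

Lemma dotp_subl m m' v : dotp (m - m') v = dotp m v - dotp m' v.
Proof. by rewrite /dotp /= !intrB; ring. Qed.

Lemma slope_unique m m' x :
  (\forall y \near x, dotp m (y - x) <= dotp m' (y - x)) -> m = m'.
Proof.
move=> near_le; apply/eqP; rewrite -subr_eq0; apply/eqP.
apply: (@dotp_eq0 R) => v.
have [t t0 [+ +]] := near0_pos (near_line v near_le).
rewrite ![x + _]addrC !addrK !dotpZ dotp_subl !mulNr lerN2 !ler_pM2l//.
by move=> h1 h2; apply/eqP; rewrite subr_eq0 eq_le h1 h2.
Qed.

Lemma enorm_ge0 x : 0 <= enorm x.
Proof. exact: sqrtr_ge0. Qed.

Lemma enormZ (t : R) v : enorm (t *: v) = `|t| * enorm v.
Proof.
rewrite /enorm /= /GRing.scale /= !exprMn -mulrDr sqrtrM ?sqr_ge0//.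
by rewrite sqrtr_sqr.
Qed.

Lemma enormN v : enorm (- v) = enorm v.
Proof. by rewrite /enorm /= !sqrrN. Qed.

Lemma enorm_gt0 v : v <> 0 -> 0 < enorm v.
Proof.
move=> v0; rewrite sqrtr_gt0 lt_neqAle addr_ge0 ?sqr_ge0// andbT eq_sym.
rewrite paddr_eq0 ?sqr_ge0// !sqrf_eq0; apply/negP => /andP[/eqP v1 /eqP v2].
by apply: v0; rewrite [v]surjective_pairing v1 v2.
Qed.

Lemma continuous_enorm : continuous (@enorm R).
Proof.
move=> x; apply: (@continuous_comp _ _ _
  (fun x : R * R => x.1 ^+ 2 + x.2 ^+ 2) Num.sqrt); last exact: sqrt_continuous.
have sq (f : R * R -> R) : {for x, continuous f} ->
    {for x, continuous (fun x => f x ^+ 2)}.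
  by move=> cf; apply: (@cvgM _ _ _ _ f f).
by apply: cvgD; apply: sq; [exact: cvg_fst|exact: cvg_snd].
Qed.

(** Lagrange's identity: the product of the norms is the absolute value of the cross product when
    the dot product vanishes. *)
Lemma enorm_mul_orthogonal m v : dotp m v = 0 ->
  enorm (embed R m) * enorm v <=
  `|m.1%:~R| * `|v.2| + `|m.2%:~R| * `|v.1|.
Proof.
move=> mv; rewrite /enorm -sqrtrM ?addr_ge0 ?sqr_ge0//= -!normrM.
have -> : (m.1%:~R ^+ 2 + m.2%:~R ^+ 2) * (v.1 ^+ 2 + v.2 ^+ 2) =
    (m.1%:~R * v.2 - m.2%:~R * v.1) ^+ 2 + (dotp m v) ^+ 2.
  by rewrite /dotp; ring.
by rewrite mv expr0n addr0 sqrtr_sqr ler_normB.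
Qed.

Lemma ediam_le S (d : R) : 0 <= d ->
  (forall x y, S x -> S y -> enorm (x - y) <= d) -> (ediam S <= d%:E)%E.
Proof.
move=> d0 H; apply: ge_ereal_sup => _ [->|[p /= [Sx Sy] <-]].
  by rewrite lee_fin.
by rewrite lee_fin; exact: H.
Qed.

Lemma ediam_ge0 S : (0 <= ediam S)%E.
Proof. by apply: ereal_sup_ubound; left. Qed.

Lemma le_enorm_ediam S x y : S x -> S y -> ((enorm (x - y))%:E <= ediam S)%E.
Proof. by move=> Sx Sy; apply: ereal_sup_ubound; right; exists (x, y). Qed.

Lemma subset_ediam S S' : S `<=` S' -> (ediam S <= ediam S')%E.
Proof.
move=> SS; apply: ge_ereal_sup => _ [->|[p /= [Sx Sy] <-]].
  exact: ediam_ge0.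
by apply: le_enorm_ediam; exact: SS.
Qed.

Lemma compact_ediam S : compact S -> S !=set0 ->
  exists x y, [/\ S x, S y & ediam S = (enorm (x - y))%:E].
Proof.
move=> cS [z Sz].
have cf : continuous (fun p : (R * R) * (R * R) => enorm (p.1 - p.2)).
  move=> p; apply: (@continuous_comp _ _ _
    (fun p : (R * R) * (R * R) => p.1 - p.2) (@enorm R)).
    by apply: cvgB; [exact: cvg_fst|exact: cvg_snd].
  exact: continuous_enorm.
have [||p Sp pmax] := compact_EVT_max (A := S `*` S)
    (f := fun p : (R * R) * (R * R) => enorm (p.1 - p.2)) _ (compact_setX cS cS).
- by exists (z, z).
- exact: continuous_subspaceT.
move: Sp; rewrite inE => -[S1 S2]; exists p.1, p.2; split=> //.
apply/eqP; rewrite eq_le le_enorm_ediam// andbT.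
apply: ediam_le => [|x y Sx Sy]; first exact: enorm_ge0.
by apply: (pmax (x, y)); rewrite inE.
Qed.

Lemma closure_le S (f g : R * R -> R) x : continuous f -> continuous g ->
  (forall y, S y -> f y <= g y) -> closure S x -> f x <= g x.
Proof.
move=> cf cg fg Sx; rewrite leNgt; apply/negP => gf.
have cfg : {for x, continuous (fun y => f y - g y)}.
  by apply: cvgB; [exact: cf|exact: cg].
have H : \forall z \near f x - g x, 0 < z by apply: lt_nbhsr; rewrite subr_gt0.
have Hx : \forall y \near x, 0 < f y - g y by exact: (cfg _ H).
have [y [Sy]] := Sx _ Hx.
by rewrite /= subr_gt0 ltNge fg.
Qed.

End EuclideanNorm.

(** * Lexicographic order on slopes *)

Definition lexlt (m m' : int * int) : bool :=
  (m.1 < m'.1) || (m.1 == m'.1) && (m.2 < m'.2).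

Lemma lexlt_irr m : lexlt m m = false.
Proof. by rewrite /lexlt; lia. Qed.

Lemma lexlt_total m m' : ~~ lexlt m m' -> ~~ lexlt m' m -> m = m'.
Proof.
rewrite /lexlt => h1 h2; rewrite [m]surjective_pairing [m']surjective_pairing.
by congr pair; lia.
Qed.

Lemma exists_lex_extrema (s : seq (int * int)) m : m \in s ->
  exists m0 m1, [/\ m0 \in s, m1 \in s &
    forall m, m \in s -> ~~ lexlt m m0 /\ ~~ lexlt m1 m].
Proof.
elim: s m => // a s IH m _.
case: s IH => [|b s] IH.
  exists a, a; split; rewrite ?inE// => m'; rewrite inE => /eqP ->.
  by rewrite lexlt_irr.
have [m0 [m1 [s0 s1 H]]] := IH b (mem_head _ _).
pose n0 := if lexlt a m0 then a else m0; pose n1 := if lexlt m1 a then a else m1.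
exists n0, n1; split.
- by rewrite /n0; case: ifP => _; rewrite inE ?eqxx ?s0 ?orbT.
- by rewrite /n1; case: ifP => _; rewrite inE ?eqxx ?s1 ?orbT.
move=> m'; rewrite inE => /orP[/eqP ->|/H]; rewrite /n0 /n1 /lexlt;
  do 2 case: ifP; lia.
Qed.

(* Positive coefficients, so that an affine function whose slope is
   lexicographically between two others is a convex combination of them. *)
Lemma lexlt_collinear (m0 m m1 : int * int) : lexlt m0 m -> lexlt m m1 ->
  (m.1 - m0.1) * (m1.2 - m.2) = (m.2 - m0.2) * (m1.1 - m.1) ->
  exists a b : int, [/\ 0 < a, 0 < b &
    forall (R : realType) (v : R * R), a%:~R * dotp (m - m0) v = b%:~R * dotp (m1 - m) v].
Proof.
move=> h0 h1 cross.
have [a [b [a0 b0 e1 e2]]] : exists a b : int, [/\ 0 < a, 0 < b,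
    a * (m.1 - m0.1) = b * (m1.1 - m.1) & a * (m.2 - m0.2) = b * (m1.2 - m.2)].
  move: h0 h1; rewrite /lexlt => /orP[u1|/andP[/eqP u1 u2]] /orP[v1|/andP[/eqP v1 v2]].
  - by exists (m1.1 - m.1), (m.1 - m0.1); split; nia.
  - exfalso; nia.
  - exfalso; nia.
  - by exists (m1.2 - m.2), (m.2 - m0.2); split; nia.
exists a, b; split=> // R v; rewrite /dotp /= !mulrDr !mulrA -!intrM.
by rewrite e1 e2.
Qed.

(** * Edges of the corner locus *)

Section Contact.
Variables (R : realType) (Om : halfplanes R).
Hypothesis HOm : bounded_rational_polygon Om.
Variables (F : R * R -> R) (A : seq (int * int)) (c : int * int -> R).
Hypothesis F_rep : min_rep Om F A c.
Implicit Types (x y z p q v : R * R) (m : int * int) (e : (int * int) * (int * int)).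

(** A closed substitute for [edge], including boundary points, so that its diameter is attained. *)
Definition contact e : set (R * R) :=
  [set x | [/\ region Om x, F x = c e.1 + dotp e.1 x & F x = c e.2 + dotp e.2 x]].

Lemma min_rep_le m x : m \in A -> region Om x -> F x <= c m + dotp m x.
Proof. by move=> mA rx; exact: (F_rep rx).1. Qed.

Lemma min_rep_concave x y (t : R) : region Om x -> region Om y -> 0 <= t <= 1 ->
  (1 - t) * F x + t * F y <= F (x + t *: (y - x)).
Proof.
move=> rx ry t01; have [_ [m mA ->]] := F_rep (region_segment rx ry t01).
have := min_rep_le mA rx; have := min_rep_le mA ry; case/andP: t01 => t0 t1.
rewrite dotp_line dotpB => hy hx.
have h1 : t * F y <= t * (c m + dotp m y) by rewrite ler_wpM2l.
have h2 : (1 - t) * F x <= (1 - t) * (c m + dotp m x) by rewrite ler_wpM2l ?subr_ge0.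
lra.
Qed.

Lemma contact_convex e x y (t : R) : e.1 \in A -> e.2 \in A ->
  contact e x -> contact e y -> 0 <= t <= 1 -> contact e (x + t *: (y - x)).
Proof.
move=> e1 e2 [rx x1 x2] [ry y1 y2] t01.
have rz := region_segment rx ry t01; have := min_rep_concave rx ry t01.
have E m : F x = c m + dotp m x -> F y = c m + dotp m y ->
    (1 - t) * F x + t * F y = c m + dotp m (x + t *: (y - x)).
  by move=> -> ->; rewrite dotp_line dotpB; ring.
split=> //; apply/eqP; rewrite eq_le min_rep_le//=.
  by rewrite -E.
by rewrite -(E e.2).
Qed.

Lemma contact_compact e : e.1 \in A -> e.2 \in A -> compact (contact e).
Proof.
move=> e1 e2.
(* Affine inequalities replace the equations in [F], so that closedness follows from the continuity
   of affine functions. *)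
pose C := [set x : R * R | forall m, m \in A ->
  c e.1 + dotp e.1 x <= c m + dotp m x /\ c e.2 + dotp e.2 x <= c m + dotp m x].
have -> : contact e = region Om `&` C.
  apply/seteqP; split=> x.
    move=> [rx x1 x2]; split=> // m mA.
    by rewrite -x1 -x2; split; exact: min_rep_le.
  move=> [rx Cx]; have [_ [m mA Fm]] := F_rep rx; have [h1 h2] := Cx m mA.
  split=> //; apply/eqP; rewrite eq_le min_rep_le//= Fm //.
apply: compact_closedI; first exact: polygon_compact HOm.
have clC m m0 x : m \in A ->
    (forall y, C y -> c m0 + dotp m0 y <= c m + dotp m y) -> closure C x ->
    c m0 + dotp m0 x <= c m + dotp m x.
  by move=> mA; apply: (closure_le (f := fun y => c m0 + dotp m0 y)
    (g := fun y => c m + dotp m y)); exact: continuous_affine.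
move=> x Cx m mA; split; apply: (clC _ _ x mA _ Cx) => y Cy.
  exact: (Cy m mA).1.
exact: (Cy m mA).2.
Qed.

(** Supergradients of a concave function are monotone; for [x] and [y] on a horizontal or vertical
    line this is the decrease of slopes used in slicing. *)
Lemma contact_slope_monotone e e' x y m m' : e.1 \in A -> e.2 \in A ->
  e'.1 \in A -> e'.2 \in A -> contact e x -> contact e' y ->
  m \in [:: e.1; e.2] -> m' \in [:: e'.1; e'.2] ->
  dotp m' (y - x) <= dotp m (y - x).
Proof.
move=> e1 e2 e1' e2' [rx x1 x2] [ry y1 y2] me me'.
have [mA xm] : m \in A /\ F x = c m + dotp m x.
  by move: me; rewrite !inE => /orP[] /eqP ->.
have [mA' ym] : m' \in A /\ F y = c m' + dotp m' y.
  by move: me'; rewrite !inE => /orP[] /eqP ->.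
have := min_rep_le mA ry; have := min_rep_le mA' rx.
rewrite !dotpB; lra.
Qed.

(* An edge of the corner locus is named by the lexicographic extremes of the
   slopes active along it; in this form two edges overlapping in a segment
   have to coincide. *)
Definition extremal_pair e : Prop :=
  [/\ e.1 \in A, e.2 \in A, lexlt e.1 e.2 & exists p q,
    [/\ p <> q, contact e p, contact e q & forall m, m \in A ->
      F p = c m + dotp m p -> F q = c m + dotp m q ->
      ~~ lexlt m e.1 /\ ~~ lexlt e.2 m]].

Lemma slope_diff_neq0 m m' : m <> m' ->
  ((m - m').1%:~R, (m - m').2%:~R) <> (0, 0) :> R * R.
Proof.
move=> mm' [/eqP + /eqP]; rewrite !intr_eq0 /= !subr_eq0 => /eqP h1 /eqP h2.
by apply: mm'; rewrite [m]surjective_pairing h1 h2 -surjective_pairing.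
Qed.

(** As its two slopes differ, [contact e] lies on a line, and affine functions that agree at two
    points of a line agree on all of it. Extremality can thus be tested at any two contact
    points. *)
Lemma active_on_contact e p q a m : e.1 <> e.2 -> p <> q ->
  contact e p -> contact e q -> contact e a ->
  F p = c m + dotp m p -> F q = c m + dotp m q -> F a = c m + dotp m a.
Proof.
move=> ee pq [_ p1 p2] [_ q1 q2] [_ a1 a2] pm qm.
have d1 : dotp (e.1 - e.2) (p - q) = 0 by rewrite dotp_subl !dotpB; lra.
have d2 : dotp (e.1 - e.2) (a - p) = 0 by rewrite dotp_subl !dotpB; lra.
have d3 : dotp (m - e.1) (p - q) = 0 by rewrite dotp_subl !dotpB; lra.
have par : (p - q).1 * (a - p).2 = (p - q).2 * (a - p).1.
  exact: orthogonal_parallel (slope_diff_neq0 ee) d1 d2.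
have d4 : dotp (m - e.1) (a - p) = 0.
  have h1 : (p - q).1 * dotp (m - e.1) (a - p) = 0.
    transitivity ((a - p).1 * dotp (m - e.1) (p - q)); last by rewrite d3 mulr0.
    transitivity ((m - e.1).1%:~R * ((p - q).1 * (a - p).1) +
      (m - e.1).2%:~R * ((p - q).1 * (a - p).2)); first by rewrite /dotp; ring.
    by rewrite par /dotp; ring.
  have h2 : (p - q).2 * dotp (m - e.1) (a - p) = 0.
    transitivity ((a - p).2 * dotp (m - e.1) (p - q)); last by rewrite d3 mulr0.
    transitivity ((m - e.1).1%:~R * ((p - q).2 * (a - p).1) +
      (m - e.1).2%:~R * ((p - q).2 * (a - p).2)); first by rewrite /dotp; ring.
    by rewrite -par /dotp; ring.
  move/eqP: h1; rewrite mulf_eq0 => /orP[/eqP z1|/eqP//].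
  move/eqP: h2; rewrite mulf_eq0 => /orP[/eqP z2|/eqP//].
  exfalso; apply: pq; apply/eqP; rewrite -subr_eq0.
  by rewrite [p - q]surjective_pairing z1 z2.
have d4' : dotp m a - dotp e.1 a - (dotp m p - dotp e.1 p) = 0.
  by rewrite -d4 dotp_subl !dotpB; ring.
lra.
Qed.

Lemma extremal_pair_neq e : extremal_pair e -> e.1 <> e.2.
Proof. by case=> _ _ + _ e12; rewrite e12 lexlt_irr. Qed.

Lemma extremal_pair_inj e e' p q : extremal_pair e -> extremal_pair e' ->
  contact e p -> contact e' p -> contact e q -> contact e' q -> p <> q ->
  e = e'.
Proof.
move=> ge ge' ep e'p eq e'q pq.
have ext f f' : extremal_pair f -> extremal_pair f' -> contact f p ->
    contact f' p -> contact f q -> contact f' q ->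
    ~~ lexlt f'.1 f.1 /\ ~~ lexlt f.2 f'.2.
  move=> gf gf' fp f'p fq f'q.
  have ff := extremal_pair_neq gf; have [f1 f2 _ [a [b [_ fa fb H]]]] := gf.
  have [f1' f2' _ _] := gf'.
  have act m : F p = c m + dotp m p -> F q = c m + dotp m q -> m \in A ->
      ~~ lexlt m f.1 /\ ~~ lexlt f.2 m.
    by move=> pm qm mA; apply: (H m mA); [exact: active_on_contact pq fp fq fa pm qm|
      exact: active_on_contact pq fp fq fb pm qm].
  case: f'p f'q => _ p1 p2 [_ q1 q2].
  by split; [exact: (act _ p1 q1 f1').1|exact: (act _ p2 q2 f2').2].
have [h1 h2] := ext _ _ ge ge' ep e'p eq e'q.
have [h3 h4] := ext _ _ ge' ge e'p ep e'q eq.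
rewrite [e]surjective_pairing [e']surjective_pairing.
by congr pair; apply: lexlt_total.
Qed.

Lemma exists_extremal_pair e x y : e.1 \in A -> e.2 \in A -> e.1 <> e.2 ->
  x <> y -> contact e x -> contact e y ->
  exists2 e', extremal_pair e' & contact e' x.
Proof.
move=> e1 e2 ee xy ex ey.
pose s := [seq m <- A | (F x == c m + dotp m x) && (F y == c m + dotp m y)].
have sP m : m \in s = [&& F x == c m + dotp m x, F y == c m + dotp m y & m \in A].
  by rewrite mem_filter andbA.
case: (ex) (ey) => rx x1 x2 [ry y1 y2].
have s1 : e.1 \in s by rewrite sP -x1 -y1 !eqxx.
have s2 : e.2 \in s by rewrite sP -x2 -y2 !eqxx.
have [m0 [m1 [m0s m1s H]]] := exists_lex_extrema s1.
move: (m0s) (m1s); rewrite !sP.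
move=> /and3P[/eqP x0 /eqP y0 mA0] /and3P[/eqP x1' /eqP y1' mA1].
exists (m0, m1); last by split.
split=> //=; last first.
  exists x, y; split=> // m mA xm ym; apply: H.
  by rewrite sP -xm -ym !eqxx.
have [H1 H2] := H _ s1; have [H3 H4] := H _ s2.
apply/negPn/negP => H5; apply: ee.
move: H1 H2 H3 H4 H5; rewrite /lexlt => H1 H2 H3 H4 H5.
by rewrite [e.1]surjective_pairing [e.2]surjective_pairing; congr pair; lia.
Qed.

Lemma linearity_region_rep m x : linearity_region Om F m x ->
  m \in A /\ F x = c m + dotp m x.
Proof.
move=> [ix near_x]; have rx := interior_subset ix.
have [_ [m' mA' Fm']] := F_rep rx.
suff -> : m = m' by [].
apply: (@slope_unique R _ _ x); apply: filterS2 near_x ix => y Fy ry.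
have := min_rep_le mA' ry; rewrite Fy Fm' [dotp m' (_ - _)]dotpB; lra.
Qed.

Lemma closure_linearity_region m x : closure (linearity_region Om F m) x ->
  region Om x -> m \in A /\ F x = c m + dotp m x.
Proof.
move=> clx rx.
have mA : m \in A.
  have [y [my _]] := clx setT filterT.
  exact: (linearity_region_rep my).1.
split=> //; apply/eqP; rewrite eq_le min_rep_le//=.
have [_ [m' mA' ->]] := F_rep rx.
apply: (closure_le (f := fun y => c m + dotp m y)
  (g := fun y => c m' + dotp m' y) _ _ _ clx); try exact: continuous_affine.
move=> y my; have [_ <-] := linearity_region_rep my.
by apply: min_rep_le => //; apply: interior_subset; exact: my.1.
Qed.

Lemma edge_contact e : edge Om F e.1 e.2 `<=` contact e.
Proof.
move=> x [[c1 c2] ix]; have rx := interior_subset ix.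
by split=> //; [exact: (closure_linearity_region c1 rx).2|
  exact: (closure_linearity_region c2 rx).2].
Qed.

(** The differences of the three slopes are orthogonal to [p - q], so the middle affine function is
    a convex combination of the outer two. Where it equals [F], which lies below both, all three
    agree; this confines its contact with [F] to a line, leaving no open region. *)
Lemma no_middle_slope m0 m m1 p q : m0 \in A -> m1 \in A ->
  lexlt m0 m -> lexlt m m1 -> p <> q ->
  contact (m0, m1) p -> contact (m0, m1) q ->
  F p = c m + dotp m p -> F q = c m + dotp m q ->
  linearity_region Om F m !=set0 -> False.
Proof.
move=> A0 A1 lt0 lt1 pq [_ /= p0 p1] [_ /= q0 q1] pm qm [x mx].
have d0 : dotp (m - m0) (p - q) = 0 by rewrite dotp_subl !dotpB; lra.
have d1 : dotp (m1 - m) (p - q) = 0 by rewrite dotp_subl !dotpB; lra.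
have pq0 : ((p - q).1, (p - q).2) <> (0, 0).
  by rewrite -surjective_pairing => /eqP; rewrite subr_eq0 => /eqP.
have cross : (m.1 - m0.1) * (m1.2 - m.2) = (m.2 - m0.2) * (m1.1 - m.1).
  apply/eqP; rewrite -(eqr_int R) !intrM; apply/eqP.
  apply: (orthogonal_parallel pq0); [rewrite -d0|rewrite -d1]; rewrite /dotp /=; ring.
have [a [b [a0 b0 ab]]] := lexlt_collinear lt0 lt1 cross.
have a0R : 0 < a%:~R :> R by rewrite ltr0z.
have b0R : 0 < b%:~R :> R by rewrite ltr0z.
have zero y : region Om y -> F y = c m + dotp m y -> dotp (m - m0) (y - p) = 0.
  move=> ry ym; have h0 := min_rep_le A0 ry; have h1 := min_rep_le A1 ry.
  have e0 : dotp (m - m0) (y - p) <= 0 by rewrite dotp_subl !dotpB; lra.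
  have e1 : 0 <= dotp (m1 - m) (y - p) by rewrite dotp_subl !dotpB; lra.
  apply/eqP; rewrite eq_le e0 /= -(ler_pM2l a0R) mulr0 ab.
  by rewrite mulr_ge0// ltW.
have [ix near_x] := mx; have rx := interior_subset ix.
have [mA xm] := linearity_region_rep mx.
have near0 : \forall y \near x, dotp (m - m0) (y - p) = 0.
  apply: filterS2 near_x ix => y Fy ry; apply: zero => //.
  by rewrite Fy xm dotpB; ring.
have : m - m0 = (0, 0).
  apply: (@dotp_eq0 R) => v.
  have [t t0 [+ _]] := near0_pos (near_line v near0).
  have := zero _ rx xm; rewrite !dotpB dotp_line => h1 h2.
  have : t * dotp (m - m0) v = 0 by lra.
  by move/eqP; rewrite mulf_eq0 gt_eqF//= => /eqP.
move/eqP; rewrite subr_eq0 => /eqP mm0.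
by move: lt0; rewrite mm0 lexlt_irr.
Qed.

(** An active slope beyond one end of the pair would put that end in the middle, although both ends
    have nonempty linearity regions. *)
Lemma edges_extremal e : edges Om F e -> extremal_pair e.
Proof.
move=> [lt [p [q [ep eq pq]]]].
have nonempty m x : closure (linearity_region Om F m) x ->
    linearity_region Om F m !=set0.
  by move=> /(_ setT filterT) [y [? _]]; exists y.
have [[c1 c2] ip] := ep; have rp := interior_subset ip.
have [A1 _] := closure_linearity_region c1 rp.
have [A2 _] := closure_linearity_region c2 rp.
have cp := edge_contact ep; have cq := edge_contact eq.
split=> //; exists p, q; split=> // m mA pm qm.
case: (cp) (cq) => _ p1 p2 [rq q1 q2].
split; apply/negP => ltm.
- by apply: (@no_middle_slope m e.1 e.2 p q) => //; exact: nonempty c1.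
- by apply: (@no_middle_slope e.1 e.2 m p q) => //; exact: nonempty c2.
Qed.

End Contact.

(** * Length and area bounds *)

Section FiniteCover.
Variable R : realType.
Implicit Types (S : set (R * R)) (delta C : R).

Definition finite_cover delta S (C : R) : Prop := exists s : seq (set (R * R)),
  [/\ forall x, S x -> exists2 i, (i < size s)%N & nth set0 s i x,
      forall i, (i < size s)%N -> (ediam (nth set0 s i) <= delta%:E)%E
    & (\sum_(i < size s) ediam (nth set0 s i) <= C%:E)%E].

Lemma hausdorff1_delta_le delta S C : 0 < delta -> finite_cover delta S C ->
  (hausdorff1_delta delta S <= C%:E)%E.
Proof.
move=> d0 [s [cov small sumC]].
have ediam0 : ediam (set0 : set (R * R)) = 0%E.
  by apply/eqP; rewrite eq_le ediam_ge0 andbT; apply: ediam_le.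
apply: le_trans sumC; apply: ereal_inf_lbound; exists (nth set0 s).
  split=> [x /cov[i _ six]|i]; first by exists i.
  have [/small//|si] := ltnP i (size s).
  by rewrite nth_default// ediam0 lee_fin ltW.
rewrite (nneseries_split 0 (size s)); last by move=> i _; exact: ediam_ge0.
rewrite add0n eseries0 ?adde0 ?big_mkord//.
by move=> i si _; rewrite nth_default.
Qed.

Lemma finite_coverU delta S S1 S2 C1 C2 : finite_cover delta S1 C1 ->
  finite_cover delta S2 C2 -> S `<=` S1 `|` S2 ->
  finite_cover delta S (C1 + C2).
Proof.
move=> [s1 [cov1 small1 sum1]] [s2 [cov2 small2 sum2]] SS.
exists (s1 ++ s2); split.
- move=> x /SS[/cov1[i is1 six]|/cov2[i is2 six]].
    by exists i; rewrite ?size_cat ?nth_cat ?is1// ltn_addr.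
  exists (size s1 + i)%N; first by rewrite size_cat ltn_add2l.
  by rewrite nth_cat ltnNge leq_addr /= addKn.
- move=> i; rewrite size_cat nth_cat; case: (ltnP i (size s1)) => [is1 _|is1 is2].
    exact: small1.
  by apply: small2; rewrite ltn_subLR.
- rewrite size_cat big_split_ord /= EFinD; apply: leeD.
    by under eq_bigr => i _ do rewrite nth_cat ltn_ord.
  by under eq_bigr => i _ do rewrite nth_cat ltnNge leq_addr /= addKn.
Qed.

Lemma finite_cover_sum (T : eqType) (r : seq T) delta S (D : T -> set (R * R))
    (C : T -> R) :
  (forall e, e \in r -> finite_cover delta (D e) (C e)) ->
  (forall x, S x -> exists2 e, e \in r & D e x) ->
  finite_cover delta S (\sum_(e <- r) C e).
Proof.
elim: r S => [|e r IH] S cov SD.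
  exists [::]; split=> //= [x /SD[]//|]; by rewrite big_ord0 big_nil.
rewrite big_cons.
apply: (@finite_coverU _ _ (D e) [set x | exists2 e, e \in r & D e x]).
- by apply: cov; rewrite mem_head.
- by apply: IH => // e' e'r; apply: cov; rewrite inE e'r orbT.
- move=> x /SD[e']; rewrite inE => /orP[/eqP -> //|e'r De']; first by left.
  by right; exists e'.
Qed.

Lemma finite_cover_subsingleton delta S : 0 < delta ->
  (forall x y, S x -> S y -> x = y) -> finite_cover delta S 0.
Proof.
move=> d0 S1.
have S0 : (ediam S <= 0%:E)%E.
  apply: ediam_le => // x y Sx Sy; rewrite (S1 x y Sx Sy) subrr.
  by rewrite /enorm /= !expr0n /= addr0 sqrtr0.
exists [:: S]; split=> /=.
- by move=> x Sx; exists 0%N.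
- by move=> [|//] _ /=; apply: (le_trans S0); rewrite lee_fin ltW.
- by rewrite big_ord1.
Qed.

Lemma finite_cover_segment delta S (x v : R * R) : 0 < delta ->
  (forall z, S z -> exists2 t : R, 0 <= t <= 1 & z = x + t *: v) ->
  finite_cover delta S (enorm v).
Proof.
move=> d0 Sseg; pose n := (Num.bound (enorm v / delta)).+1.
have n0 : 0 < n%:R :> R by rewrite ltr0n.
have nd : enorm v / n%:R <= delta.
  rewrite ler_pdivrMr// mulrC -ler_pdivrMr//; apply: ltW.
  apply: (lt_le_trans (archi_boundP _)); first by rewrite divr_ge0 ?enorm_ge0// ltW.
  by rewrite ler_nat.
pose U (i : nat) : set (R * R) :=
  [set z | exists2 t : R, i%:R / n%:R <= t <= i.+1%:R / n%:R & z = x + t *: v].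
have Ud i : (ediam (U i) <= (enorm v / n%:R)%:E)%E.
  apply: ediam_le => [|_ _ [t /andP[t1 t2] ->] [u /andP[u1 u2] ->]].
    by rewrite divr_ge0 ?enorm_ge0// ltW.
  rewrite opprD addrACA subrr add0r -scalerBl enormZ mulrC.
  apply: ler_wpM2l; first exact: enorm_ge0.
  have E : i.+1%:R / n%:R = i%:R / n%:R + n%:R^-1 :> R.
    by rewrite -natr1 mulrDl mul1r.
  by rewrite ler_norml; apply/andP; split; lra.
exists (mkseq U n); rewrite size_mkseq; split.
- move=> z /Sseg[t /andP[t0 t1] ->].
  pose i := Num.truncn (t * n%:R).
  have tn0 : 0 <= t * n%:R by rewrite mulr_ge0// ltW.
  have /andP[it ti] : i%:R <= t * n%:R < i.+1%:R by exact: truncn_itv.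
  have [iltn|nlei] := ltnP i n.
    exists i => //; rewrite nth_mkseq//; exists t => //.
    by rewrite ler_pdivrMr// it /= ler_pdivlMr// ltW.
  (* Truncation leaves the range only for [t = 1], the right end of the last piece. *)
  exists n.-1 => //; rewrite nth_mkseq//; exists t => //.
  have -> : t = 1.
    apply/eqP; rewrite eq_le t1 /= -(ler_pM2r n0) mul1r.
    by apply: le_trans it; rewrite ler_nat.
  by rewrite ler_pdivrMr// mul1r ler_nat leq_pred /= divff// gt_eqF.
- by move=> i iltn; rewrite nth_mkseq//; apply: (le_trans (Ud i)); rewrite lee_fin.
- under eq_bigr => i _ do rewrite nth_mkseq//.
  apply: (@le_trans _ _ (\sum_(i < n) (enorm v / n%:R)%:E)%E).
    by apply: lee_sum => i _; exact: Ud.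
  by rewrite sumEFin sumr_const card_ord -[_ *+ n]mulr_natr divfK// gt_eqF.
Qed.

End FiniteCover.

(** * Sums of gradient jump times length *)

Section LengthBounds.
Variables (R : realType) (Om : halfplanes R).
Hypothesis HOm : bounded_rational_polygon Om.
Variables (F : R * R -> R) (A : seq (int * int)) (c : int * int -> R).
Hypothesis F_rep : min_rep Om F A c.
Variables (M : nat) (B : R).
Hypothesis A_le : forall m, m \in A -> (`|m.1| <= M)%N /\ (`|m.2| <= M)%N.
Hypothesis B_ge0 : 0 <= B.
Hypothesis region_le : forall x, region Om x -> `|x.1| <= B /\ `|x.2| <= B.
Implicit Types (x y z : R * R) (m : int * int) (e : (int * int) * (int * int)).

Local Notation contact := (contact Om F c).
Local Notation extremal_pair := (extremal_pair Om F A c).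

Lemma sum_extremal_le s (a b : (int * int) * (int * int) -> R * R) :
  uniq s -> (forall e, e \in s -> extremal_pair e) ->
  (forall e, e \in s -> contact e (a e) /\ contact e (b e)) ->
  \sum_(e <- s) enorm (embed R (e.2 - e.1)) * enorm (a e - b e) <=
    8 * M%:R * B.
Proof.
move=> us ext ab.
have inA e : e \in s -> e.1 \in A /\ e.2 \in A by move=> /ext[].
have mono e e' x y m m' : e \in s -> e' \in s -> contact e x -> contact e' y ->
    m \in [:: e.1; e.2] -> m' \in [:: e'.1; e'.2] ->
    dotp m' (y - x) <= dotp m (y - x).
  by move=> /inA[e1 e2] /inA[e1' e2']; exact: (contact_slope_monotone F_rep).
have range e : e \in s -> [/\ - M%:Z <= e.1.1, e.1.1 <= e.2.1 & e.2.1 <= M%:Z] /\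
    [/\ - M%:Z <= Num.min e.1.2 e.2.2, Num.min e.1.2 e.2.2 <= Num.max e.1.2 e.2.2
      & Num.max e.1.2 e.2.2 <= M%:Z].
  move=> es; have [e1 e2] := inA e es; have [_ _ lt _] := ext e es.
  have := A_le e1; have := A_le e2; move: lt; rewrite /lexlt => lt h1 h2.
  move: lt h1 h2; case: (e) => [[u v] [w z]] /= lt h1 h2.
  by split; split; lia.
have height : \sum_(e <- s) (e.2.1 - e.1.1)%:~R * `|(a e).2 - (b e).2| <= 4 * M%:R * B.
  apply: (@sum_slope_drop_height R _ s contact a b (fun e => e.1.1) (fun e => e.2.1)) => //.
  - by move=> e /range[].
  - by move=> e x _ [rx _ _]; exact: (region_le rx).2.
  - by move=> e x y t /inA[e1 e2]; exact: (contact_convex F_rep).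
  - move=> e e' x y es es' ex ey xy2 xy1.
    have := mono e e' x y e.1 e'.2 es es' ex ey; rewrite !inE !eqxx ?orbT => /(_ isT isT).
    rewrite /dotp /= xy2 subrr !mulr0 !addr0 ler_pM2r ?subr_gt0//.
    by rewrite ler_int.
  - by move=> e e' x y /ext ge /ext ge' ex e'x ey e'y xy;
    exact: extremal_pair_inj ge ge' ex e'x ey e'y xy.
(* The other slicing is the same estimate after exchanging coordinates. Lexicographic order does not
   sort the second coordinates of the slopes, hence [Num.min] and [Num.max]. *)
pose sw (x : R * R) := (x.2, x.1).
have width : \sum_(e <- s) (Num.max e.1.2 e.2.2 - Num.min e.1.2 e.2.2)%:~R *
    `|(a e).1 - (b e).1| <= 4 * M%:R * B.
  apply: (@sum_slope_drop_height R _ s (fun e => [set x | contact e (sw x)])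
    (sw \o a) (sw \o b) (fun e => Num.min e.1.2 e.2.2) (fun e => Num.max e.1.2 e.2.2)) => //.
  - by move=> e /range[].
  - move=> e es; have [] := ab e es; rewrite /sw /=.
    by rewrite -!surjective_pairing.
  - by move=> e x _ [rx _ _]; exact: (region_le rx).1.
  - move=> e x y t /inA[e1 e2] ex ey t01.
    exact: (contact_convex F_rep e1 e2 ex ey t01).
  - move=> e e' x y es es' ex ey xy2 xy1.
    have H m m' : m \in [:: e.1; e.2] -> m' \in [:: e'.1; e'.2] -> m'.2 <= m.2.
      move=> me me'; have := mono e e' _ _ m m' es es' ex ey me me'.
      rewrite /dotp /= xy2 subrr !mulr0 !add0r ler_pM2r ?subr_gt0//.
      by rewrite ler_int.
    have := H e.1 e'.1; have := H e.1 e'.2; have := H e.2 e'.1; have := H e.2 e'.2.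
    rewrite !inE !eqxx !orbT => /(_ isT isT) h1 /(_ isT isT) h2 /(_ isT isT) h3 /(_ isT isT) h4.
    by rewrite ge_max !le_min h1 h2 h3 h4.
  - move=> e e' x y /ext ge /ext ge' ex e'x ey e'y xy.
    apply: (extremal_pair_inj ge ge' ex e'x ey e'y) => -[e2 e1]; apply: xy.
    by rewrite [x]surjective_pairing e1 e2 -surjective_pairing.
apply: (@le_trans _ _ (4 * M%:R * B + 4 * M%:R * B)); last by lra.
apply: (le_trans _ (lerD height width)); rewrite -big_split /=.
rewrite big_seq [leRHS]big_seq; apply: ler_sum => e es; have [[_ a1 a2] [_ b1 b2]] := ab e es.
have d0 : dotp (e.2 - e.1) (a e - b e) = 0 by rewrite dotp_subl !dotpB; lra.
apply: (le_trans (enorm_mul_orthogonal d0)); apply: lerD.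
  apply: ler_wpM2r => //; rewrite /= -intr_norm ler_int.
  by have [_ _ + _] := ext e es; rewrite /lexlt; case: (e) => [[u v] [w z]] /=; lia.
by apply: ler_wpM2r => //; rewrite /= -intr_norm ler_int;
  case: (e) => [[u v] [w z]] /=; lia.
Qed.

Lemma contact_ediam e : extremal_pair e -> exists x y,
  [/\ contact e x, contact e y & ediam (contact e) = (enorm (x - y))%:E].
Proof.
move=> [e1 e2 _ [p [q [_ ep _ _]]]].
apply: compact_ediam; first exact: (contact_compact HOm F_rep).
by exists p.
Qed.

Definition contact_length e : R := fine (ediam (contact e)).

Lemma contact_lengthE e : extremal_pair e ->
  (contact_length e)%:E = ediam (contact e).
Proof. by move=> /contact_ediam[x [y [_ _ E]]]; rewrite /contact_length E. Qed.

Lemma contact_length_ge0 e : 0 <= contact_length e.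
Proof. by apply: fine_ge0; exact: ediam_ge0. Qed.

Lemma sum_extremal_length s : uniq s -> (forall e, e \in s -> extremal_pair e) ->
  \sum_(e <- s) enorm (embed R (e.2 - e.1)) * contact_length e <= 8 * M%:R * B.
Proof.
move=> us ext.
have /choice[f fP] e : exists p : (R * R) * (R * R), extremal_pair e ->
    [/\ contact e p.1, contact e p.2 & contact_length e = enorm (p.1 - p.2)].
  have [ge|nge] := pselect (extremal_pair e); last by exists 0.
  have [x [y [ex ey E]]] := contact_ediam ge.
  by exists (x, y) => _; split=> //; rewrite /contact_length E.
rewrite (eq_big_seq (fun e => enorm (embed R (e.2 - e.1)) * enorm ((f e).1 - (f e).2))).
  by apply: (sum_extremal_le us ext) => e /ext /fP[].
by move=> e /ext /fP[_ _ ->].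
Qed.

(** The weight restores the gcd divided out of the normal, and rotation preserves the norm. A term
    of the symplectic area is thus gradient jump times length. *)
Lemma weight_tangent_norm m0 m1 :
  (edge_weight m0 m1)%:~R * enorm (embed R (edge_tangent m0 m1)) =
  enorm (embed R (m1 - m0)).
Proof.
rewrite /edge_tangent /edge_normal /embed /=.
set g := edge_weight m0 m1.
have g0 : 0 <= g by [].
have -> : g%:~R * enorm ((- ((m1.2 - m0.2) %/ g)%Z)%:~R, ((m1.1 - m0.1) %/ g)%Z%:~R) =
    enorm (g%:~R *: ((- ((m1.2 - m0.2) %/ g)%Z)%:~R, ((m1.1 - m0.1) %/ g)%Z%:~R) : R * R).
  by rewrite enormZ ger0_norm// ler0z.
rewrite /enorm /= /GRing.scale /= -!intrM mulrN.
have -> : g * ((m1.2 - m0.2) %/ g)%Z = m1.2 - m0.2.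
  by rewrite mulrC divzK// dvdz_gcdr.
have -> : g * ((m1.1 - m0.1) %/ g)%Z = m1.1 - m0.1.
  by rewrite mulrC divzK// dvdz_gcdl.
by rewrite rmorphN sqrrN addrC.
Qed.

Lemma symp_area_le : (symp_area Om F <= (8 * M%:R * B)%:E)%E.
Proof.
(* [\esum] is a supremum of finite sums, so a uniform bound over finite sets of edges suffices. *)
apply: ge_ereal_sup => _ [X [finX XE] <-].
have [s us Xs] : exists2 s, uniq s & X = [set` s].
  have /finite_seqP[s ->] := finX; exists (undup s); first exact: undup_uniq.
  by apply/seteqP; split=> e /=; rewrite mem_undup.
rewrite {}Xs in XE *; rewrite -fsbig_seq//.
have sP e : e \in s -> extremal_pair e /\ edge Om F e.1 e.2 `<=` contact e.
  move=> /XE eE; split; first exact: (edges_extremal F_rep eE).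
  exact: (edge_contact F_rep).
apply: (@le_trans _ _ (\sum_(e <- s)
    (enorm (embed R (e.2 - e.1)) * contact_length e)%:E)%E); last first.
  by rewrite sumEFin lee_fin; apply: sum_extremal_length => // e /sP[].
rewrite big_seq [leRHS]big_seq; apply: lee_sum => e /sP[ge Ee].
rewrite -weight_tangent_norm mulrAC EFinM -/(embed R _).
rewrite EFinM contact_lengthE//.
apply: lee_wpmul2r; first by rewrite lee_fin enorm_ge0.
apply: lee_wpmul2l; first by rewrite lee_fin ler0z.
exact: subset_ediam.
Qed.

(** Take [x] and [y] realizing the diameter. Any contact point is [x + t *: (y - x)], and its
    distances to both ends, at most the diameter, give [|t| <= 1] and [|1 - t| <= 1]. *)
Lemma contact_segment e : extremal_pair e -> exists x v : R * R,
  enorm v = contact_length e /\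
  forall z, contact e z -> exists2 t : R, 0 <= t <= 1 & z = x + t *: v.
Proof.
move=> ge; have [x [y [ex ey E]]] := contact_ediam ge.
have far z w : contact e z -> contact e w -> enorm (z - w) <= enorm (y - x).
  move=> ez ew; rewrite -(enormN (y - x)) opprB -lee_fin -E.
  exact: le_enorm_ediam.
exists x, (y - x); split.
  by rewrite -(enormN (y - x)) opprB /contact_length E.
have v0 : y - x <> 0.
  move=> yx; have [_ _ _ [p [q [pq ep eq _]]]] := ge.
  have pq0 : 0 < enorm (p - q).
    by apply: enorm_gt0 => /eqP; rewrite subr_eq0 => /eqP.
  have := lt_le_trans pq0 (far _ _ ep eq).
  by rewrite yx /enorm /= expr0n addr0 sqrtr0 ltxx.
have nv := enorm_gt0 v0.
move=> z ez; case: (ex) (ey) (ez) => rx x1 x2 [ry y1 y2] [rz z1 z2].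
have d1 : dotp (e.1 - e.2) (z - x) = 0 by rewrite dotp_subl !dotpB; lra.
have d2 : dotp (e.1 - e.2) (y - x) = 0 by rewrite dotp_subl !dotpB; lra.
have par := orthogonal_parallel (slope_diff_neq0 (R := R) (extremal_pair_neq ge)) d1 d2.
have := collinear_scale v0 par; set t := (_ / _) => zE.
have zE' : z = x + t *: (y - x) by rewrite -zE addrC subrK.
exists t => //.
have t1 : `|t| <= 1.
  by rewrite -(ler_pM2r nv) mul1r -enormZ -zE far.
have t2 : `|1 - t| <= 1.
  rewrite -(ler_pM2r nv) mul1r -enormZ scalerBl scale1r -zE opprB addrA subrK.
  exact: far.
by move: t1 t2; rewrite !ler_norml => /andP[_ ->] /andP[_]; rewrite gerBl => ->.
Qed.

(** The local representation at a corner may differ from the global one. If a single global slope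
    were active at [x], then [F] would be affine near [x], and every slope active there in the local
    representation would equal it. *)
Lemma corner_locus_active x : corner_locus Om F x ->
  exists m m', [/\ m \in A, m' \in A, m <> m' & contact (m, m') x].
Proof.
move=> [ix [A' [c' [loc [m0 [m1 [m0A m1A m01 x0 x1]]]]]]].
have rx := interior_subset ix; have [_ [m mA xm]] := F_rep rx.
apply: contrapT => none.
have only m' : m' \in A -> F x = c m' + dotp m' x -> m' = m.
  move=> mA' xm'; apply: contrapT => mm'; apply: none.
  by exists m', m; split.
have near_gt : \forall y \near x, forall m', m' \in A ->
    m' = m \/ c m + dotp m y < c m' + dotp m' y.
  apply: near_all_seq => m' mA'.
  have [->|/eqP mm'] := eqVneq m' m; first by apply: filterE; left.
  pose g y := (c m' + dotp m' y) - (c m + dotp m y).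
  have gx : 0 < g x.
    rewrite subr_gt0 -xm lt_neqAle (min_rep_le F_rep mA' rx) andbT.
    by apply/eqP => /(only _ mA').
  have cg : {for x, continuous g} by apply: cvgB; exact: continuous_affine.
  have H : \forall z \near g x, 0 < z by exact: lt_nbhsr.
  have Hg : \forall y \near x, 0 < g y by exact: (cg _ H).
  by apply: filterS Hg => y; rewrite subr_gt0; right.
have near_m : \forall y \near x, F y = c m + dotp m y.
  apply: filterS2 near_gt ix => y Hy ry.
  have [_ [m' mA' ym']] := F_rep ry.
  have [<-//|] := Hy m' mA'.
  by rewrite -ym' ltNge (min_rep_le F_rep mA ry).
have eqm m' : m' \in A' -> F x = c' m' + dotp m' x -> m = m'.
  move=> mA' xm'; apply: (@slope_unique R _ _ x).
  apply: filterS2 near_m loc => y ym [/(_ _ mA') le _].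
  rewrite !dotpB; lra.
by apply: m01; rewrite -(eqm _ m0A x0) -(eqm _ m1A x1).
Qed.

Lemma enorm_slope_ge1 m m' : m <> m' -> 1 <= enorm (embed R (m' - m)).
Proof.
move=> mm'; rewrite /enorm -[1]sqrtr1 ler_wsqrtr//= -!rmorphXn -rmorphD /=.
rewrite -[1]/(1%:~R) ler_int.
have : (m'.1 - m.1 != 0) || (m'.2 - m.2 != 0).
  rewrite !subr_eq0 -negb_and; apply/negP => /andP[/eqP h1 /eqP h2].
  by apply: mm'; rewrite [m]surjective_pairing [m']surjective_pairing h1 h2.
move: (m'.1 - m.1) (m'.2 - m.2) => a b.
by move=> /orP[] ?; nia.
Qed.

(** A jump is a nonzero integer vector, of norm at least 1, so the weighted bound controls plain
    length. Corner points on no contact segment form finitely many singletons, which cost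
    nothing. *)
Lemma hausdorff1_corner_locus_le :
  (hausdorff1 (corner_locus Om F) <= (8 * M%:R * B)%:E)%E.
Proof.
apply: ge_ereal_sup => _ [delta /= d0 <-].
pose pairs := undup [seq (m, m') | m <- A, m' <- A].
have mem_pairs e : e.1 \in A -> e.2 \in A -> e \in pairs.
  by move=> e1 e2; rewrite mem_undup; apply/allpairsP; exists e; rewrite -surjective_pairing.
(* For a pair that is not extremal this is its contact point if there is exactly one, and the empty
   set otherwise; longer contact sets are covered by extremal pairs. *)
pose D e := if `[< extremal_pair e >] then contact e
  else [set x | contact e = [set x]].
pose C e := if `[< extremal_pair e >] then contact_length e else 0.
have cov : finite_cover delta (corner_locus Om F) (\sum_(e <- pairs) C e).
  apply: (finite_cover_sum (D := D)) => [e _|x].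
    rewrite /D /C; case: asboolP => [ge|_].
      have [x [v [<- seg]]] := contact_segment ge.
      exact: finite_cover_segment seg.
    apply: finite_cover_subsingleton => // x y /= -> xy.
    by have : [set y] x by rewrite -xy.
  move=> /corner_locus_active[m [m' [mA mA' mm' mx]]].
  have [[y [xy my]]|single] := pselect (exists y, x <> y /\ contact (m, m') y).
    have [e ge ex] := exists_extremal_pair (e := (m, m')) mA mA' mm' xy mx my.
    exists e; first by case: ge => ? ? _ _; exact: mem_pairs.
    by rewrite /D; case: asboolP.
  exists (m, m'); first exact: mem_pairs.
  rewrite /D; case: asboolP => // _; apply/seteqP; split=> y /=.
    by move=> my; apply: contrapT => yx; apply: single; exists y; split=> // xy; apply: yx.
  by move=> ->.
apply: (le_trans (hausdorff1_delta_le d0 cov)); rewrite lee_fin.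
apply: (@le_trans _ _ (\sum_(e <- [seq e <- pairs | `[< extremal_pair e >]])
    enorm (embed R (e.2 - e.1)) * contact_length e)).
  rewrite big_filter [leRHS]big_mkcond /=; apply: ler_sum => e _; rewrite /C.
  case: asboolP => // ge; rewrite ler_peMl ?contact_length_ge0//.
  by apply: enorm_slope_ge1; exact: extremal_pair_neq ge.
apply: sum_extremal_length; first by rewrite filter_uniq// undup_uniq.
by move=> e; rewrite mem_filter => /andP[/asboolP].
Qed.

End LengthBounds.

Theorem theorem3p10 (R : realType) (Om : halfplanes R) (K : set (R * R)) :
  bounded_rational_polygon Om ->
  compact K -> K `<=` (region Om)° ->
  exists C : R, forall (N : nat) (P : set (R * R)),
    (1 <= N)%N -> P `<=` K -> (P #= `I_N)%card ->
    let F := relaxation Om P in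
    [/\ (symp_area Om F <= (C * Num.sqrt N%:R)%:E)%E,
        (hausdorff1 (corner_locus Om F) <= (C * Num.sqrt N%:R)%:E)%E
      & (boundary_degree Om F <= (C * Num.sqrt N%:R)%:E)%E].
Proof.
move=> HOm cK Kin.
have [T HT] := exists_bounded_slope_series HOm cK Kin.
have [B B0 HB] := region_bounded HOm.
pose L := (\sum_(r < nsides Om) (`|(normal r).1| + `|(normal r).2|))%N.
have HL (r : 'I_(nsides Om)) : (`|(normal r).1| <= L)%N /\ (`|(normal r).2| <= L)%N.
  have : (`|(normal r).1| + `|(normal r).2| <= L)%N by rewrite /L (bigD1 r)//= leq_addr.
  by move=> h; split; apply: leq_trans h; rewrite ?leq_addr ?leq_addl.
(* The bounds [8 * M * B] with [M = k * L], and [nsides Om * k], after inserting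
   [k <= T * sqrt N]. *)
pose C1 : R := 8 * L%:R * B * T%:R; pose C2 : R := (nsides Om)%:R * T%:R.
have C1_ge0 : 0 <= C1 by rewrite !mulr_ge0// ltW.
have C2_ge0 : 0 <= C2 by rewrite mulr_ge0.
exists (C1 + C2) => N P N1 PK cardP F.
have [k [kT [G0 [G0_series G0_corner G0_le]]]] := HT N P N1 PK cardP.
have F_rep := relaxation_min_rep HOm HL G0_series G0_corner G0_le.
have F_ge0 x : region Om x -> 0 <= F x by exact: relaxation_ge0 G0_series G0_corner x.
have F_le (r : 'I_(nsides Om)) x : region Om x -> F x <= k%:R * lam r x.
  exact: (relaxation_le_lam G0_series G0_corner G0_le).
have A_le m : m \in exponents (k * L) -> (`|m.1| <= k * L)%N /\ (`|m.2| <= k * L)%N.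
  by rewrite mem_exponents => /andP.
have S0 : 0 <= Num.sqrt N%:R :> R := sqrtr_ge0 _.
have le1 : ((8 * (k * L)%N%:R * B)%:E <= ((C1 + C2) * Num.sqrt N%:R)%:E)%E.
  rewrite lee_fin (@le_trans _ _ (C1 * Num.sqrt N%:R))//; last first.
    by rewrite ler_wpM2r// lerDl.
  have -> : 8 * (k * L)%N%:R * B = 8 * L%:R * B * k%:R by rewrite natrM; ring.
  by rewrite /C1 -[leRHS]mulrA ler_wpM2l// !mulr_ge0// ltW.
have le2 : (((nsides Om * k)%N%:R)%:E <= ((C1 + C2) * Num.sqrt N%:R)%:E)%E.
  rewrite lee_fin (@le_trans _ _ (C2 * Num.sqrt N%:R))//; last first.
    by rewrite ler_wpM2r// lerDr.
  by rewrite natrM /C2 -mulrA ler_wpM2l.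
split.
- exact: le_trans (symp_area_le HOm F_rep A_le (ltW B0) HB) le1.
- exact: le_trans (hausdorff1_corner_locus_le HOm F_rep A_le (ltW B0) HB) le1.
- exact: le_trans (boundary_degree_le HOm F_rep F_ge0 F_le) le2.
Qed.
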